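(* For $m\in\{5,6\}$, \[ \mathcal{N}_{\mathcal P}(n,C_{2m})=\Bigl(\frac{n}{m}\Bigr)^m+o(n^m)\qquad\text{as } n\to\infty . \]
   Context: For graphs $G$ and $H$, $\mathcal N(G,H)$ denotes the number of (unlabeled) copies of $H$ in $G$, i.e. the number of subgraphs of $G$ isomorphic to $H$. For a planar graph $H$, $\mathcal{N}_{\mathcal P}(n,H)$ is the maximum of $\mathcal N(G,H)$ over all $n$-vertex planar graphs $G$. $C_k$ denotes the cycle on $k$ vertices. *)

(* Defs.v *)
From HB Require Import structures.
From mathcomp Require Import all_boot all_order all_algebra.
From mathcomp Require Import all_classical all_reals all_analysis.
Set Implicit Arguments.
Unset Strict Implicit.
Unset Printing Implicit Defensive.
Import Order.TTheory GRing.Theory Num.Theory.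
Import numFieldNormedType.Exports.
Local Open Scope ring_scope.

Section Graphs.
Variable V : finType.

Definition is_edge_set (E : {set {set V}}) : bool :=
  [forall e in E, #|e| == 2%N].

Record sgraph : Type := SGraph { edges :> {set {set V}}; _ : is_edge_set edges }.

HB.instance Definition _ := [isSub for edges].
HB.instance Definition _ := [Finite of sgraph by <:].

(* Loops are dropped and the direction of r is forgotten. *)
Definition rel_edges (r : rel V) : {set {set V}} :=
  [set e | [exists x, exists y, [&& x != y, r x y & e == [set x; y]]]]%SET.

Lemma rel_edgesP (r : rel V) : is_edge_set (rel_edges r).
Proof.
apply/forallP => e; apply/implyP; rewrite inE.
by case/existsP => x /existsP[y /and3P[xy _ /eqP->]]; rewrite cards2 xy.
Qed.

Definition graph_of_rel (r : rel V) : sgraph := SGraph (rel_edgesP r).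

(* A pair (vertex set, edge set). *)
Definition is_subgraph (G : sgraph) (S : {set V} * {set {set V}}) : bool :=
  (S.2 \subset edges G) && (S.2 \subset powerset S.1).

End Graphs.

(* ordS is the successor modulo k; this is the cycle on k vertices when k >= 3. *)
Definition cycle_graph (k : nat) : sgraph 'I_k :=
  graph_of_rel (fun i j : 'I_k => j == ordS i).

Definition iso_to (V U : finType) (S : {set V} * {set {set V}}) (H : sgraph U)
    : bool :=
  [exists f : {ffun U -> V},
    [&& injectiveb f, S.1 == (f @: [set: U])%SET
      & S.2 == [set f @: (e : {set U}) | e : {set U} in edges H]%SET]].

Definition num_copies (V U : finType) (G : sgraph V) (H : sgraph U) : nat :=
  #|[set S : {set V} * {set {set V}} | is_subgraph G S && iso_to S H]%SET|.

(* A drawing of G in the plane: distinct vertices are distinct points, each edge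
   is a simple arc joining its two end vertices, and the interior of an arc
   meets neither a vertex nor the interior of another arc. *)
Definition plane_drawing (R : realType) (V : finType) (G : sgraph V)
    (pos : V -> R * R) (arc : {set V} -> R -> R * R) : Prop :=
  [/\ injective pos,
      forall e, e \in edges G ->
        [/\ {within `[0, 1], continuous (arc e)}%classic,
            {in `[0, 1] &, injective (arc e)}
          & exists x y, [/\ e = [set x; y]%SET,
                            arc e 0 = pos x & arc e 1 = pos y]],
      forall e v t, e \in edges G -> t \in `]0, 1[ -> arc e t <> pos v
    & forall e e' t t', e \in edges G -> e' \in edges G -> e != e' ->
        t \in `]0, 1[ -> t' \in `]0, 1[ -> arc e t <> arc e' t'].

Definition planar (R : realType) (V : finType) (G : sgraph V) : Prop :=
  exists pos arc, @plane_drawing R V G pos arc.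

(* The n-vertex graphs are taken, up to isomorphism, on the vertex set 'I_n. *)
Definition max_planar_copies (R : realType) (n : nat) (U : finType)
    (H : sgraph U) : nat :=
  (\max_(G : sgraph 'I_n | `[< planar R G >]) num_copies G H)%N.

(* Main.v *)
(* Lower bound: replace every edge of C_m by about n/m paths of length two.

   Upper bound: let "heavy" vertices be those of degree more than n/K. Since
   planar graphs are hereditarily sparse, a 2m-cycle with two consecutive
   heavy or two consecutive light vertices belongs to a family of size
   O(n^m/K) + O_K(n^(m-1)), and so does one using a light vertex with three
   heavy neighbours, because there is no K_{3,3}. Every other 2m-cycle
   alternates, so it is an m-cycle on the heavy vertices with a common
   neighbour chosen for each edge. With w(x,y) the number of admissible
   common neighbours, the total of w is at most n, and it remains to see that
   the sum over m-cycles of the product of the w is at most (total/m)^m.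

   For the latter (Cox and Martin), take w maximising this sum M with total
   1. Perturbing one edge shows that the cycles through an edge e weigh m M
   w(e), so those through a vertex of degree d weigh m d M / 2; those
   avoiding it weigh at most M (1-d)^m by homogeneity. Hence 1 - md/2 <=
   (1-d)^m, which for m = 5 and m = 6 leaves room for at most m vertices of
   positive degree, and then all degrees are 2/m. Summing the weights of the
   paths that close the edges at one vertex (at least two edges, each closed
   with weight m M) bounds M by m^(-m).

   Planarity enters only through K_{3,3}-minors, which any dense graph has
   (Mader): the six disjoint connected sets would give nine polygonal paths
   of which the independent ones stay apart, and this is excluded by a
   winding-number count modulo 2 (van Kampen). *)
Require Import Defs.
From HB Require Import structures.
From mathcomp Require Import all_boot all_order all_algebra.
From mathcomp Require Import ring lra zify.
Set Implicit Arguments.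
Unset Strict Implicit.
Unset Printing Implicit Defensive.
Import Order.TTheory GRing.Theory Num.Theory.

(** * Weighted cycles and walks as lists of vertices *)

Section Seqs.
Local Open Scope ring_scope.
Variable V : finType.
Implicit Types s : seq V.

(** Plain lists rather than tuples, so that rotating, reversing or splitting off the head stays
    within one type. *)
Fixpoint seqs k : seq (seq V) :=
  if k is k'.+1 then [seq x :: s | x <- enum V, s <- seqs k'] else [:: [::]].

Lemma mem_seqs k s : (s \in seqs k) = (size s == k).
Proof.
elim: k s => [|k IH] [|x s] //=.
  by apply/negbTE/allpairsPdep => -[x [t [_ _]]].
apply/allpairsPdep/idP => [[y [t [_ tk [_ ->]]]]|sk]; first by rewrite eqSS -IH.
by exists x, s; rewrite mem_enum IH.
Qed.

Lemma seqs_uniq k : uniq (seqs k).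
Proof.
elim: k => //= k IH; apply: allpairs_uniq => //; first exact: enum_uniq.
by move=> [x s] [y t] _ _ /= [-> ->].
Qed.

Variable R : realFieldType.

Lemma big_seqsS (T : Type) (idx : T) (op : Monoid.com_law idx) k
    (P : pred (seq V)) (F : seq V -> T) :
  \big[op/idx]_(s <- seqs k.+1 | P s) F s =
  \big[op/idx]_x \big[op/idx]_(s <- seqs k | P (x :: s)) F (x :: s).
Proof.
rewrite big_mkcond /= big_allpairs_dep big_enum /=.
by apply: eq_bigr => x _; rewrite -big_mkcond.
Qed.

(** A size-preserving injection maps the finite family [seqs k] into itself, hence permutes it. It
    is applied to rotations and to reversal. *)
Lemma reindex_seqs k (g : seq V -> seq V) (P : pred (seq V)) (F : seq V -> R) :
    injective g -> (forall s, size (g s) = size s) ->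
  \sum_(s <- seqs k | P s) F s = \sum_(s <- seqs k | P (g s)) F (g s).
Proof.
move=> g_inj g_size; rewrite -(big_map g P); apply: perm_big.
have sub : {subset map g (seqs k) <= seqs k}.
  by move=> t /mapP[s]; rewrite !mem_seqs => sk ->; rewrite g_size.
have uq : uniq (map g (seqs k)) by rewrite map_inj_uniq // seqs_uniq.
rewrite perm_sym; apply: uniq_perm => //; first exact: seqs_uniq.
by have [_] := uniq_min_size uq sub (eq_leq (esym (size_map g (seqs k)))).
Qed.

(* Weights depend on the position of the step so that one step can be
   differentiated at a time, see [step_at]. *)
Fixpoint walk_weight (f : nat -> V -> V -> R) v s : R :=
  if s is u :: s' then f 0%N v u * walk_weight (f \o S) u s' else 1.

Definition cycle_weight f s : R :=
  if s is x :: s' then walk_weight f x (rcons s' x) else 1.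

Lemma eq_walk_weight f g v s : (forall i x y, (i < size s)%N -> f i x y = g i x y) ->
  walk_weight f v s = walk_weight g v s.
Proof.
elim: s f g v => //= u s IH f g v fg; rewrite fg //; congr (_ * _).
by apply: IH => i x y lt_is; apply: fg.
Qed.

Lemma walk_weight_rcons f v s z :
  walk_weight f v (rcons s z) = walk_weight f v s * f (size s) (last v s) z.
Proof.
by elim: s f v => [|u s IH] f v /=; rewrite ?mulr1 ?mul1r // IH mulrA.
Qed.

Lemma walk_weight_rev (w : V -> V -> R) v s u : (forall x y, w x y = w y x) ->
  walk_weight (fun=> w) v (rcons s u) = walk_weight (fun=> w) u (rcons (rev s) v).
Proof.
move=> ws; elim: s v => [|x s IH] v /=; first by rewrite !mulr1 ws.
rewrite (@eq_walk_weight _ (fun=> w)) // IH rev_cons [RHS]walk_weight_rcons.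
by rewrite last_rcons ws mulrC.
Qed.

Lemma walk_weight_ge0 f v s : (forall i x y, 0 <= f i x y) -> 0 <= walk_weight f v s.
Proof. by elim: s f v => //= u s IH f v f0; rewrite mulr_ge0 // IH => [|i x y] /=. Qed.

Lemma cycle_weight_ge0 f s : (forall i x y, 0 <= f i x y) -> 0 <= cycle_weight f s.
Proof. by case: s => //= x s f0; apply: walk_weight_ge0. Qed.

Definition step_at (w e : V -> V -> R) (j : nat) : nat -> V -> V -> R :=
  fun i => if i == j then e else w.

(** In the expansion of the product over the steps, the terms of order two and more in [t] are
    nonnegative and are dropped. *)
Lemma walk_weight_perturb (w e : V -> V -> R) t v s : 0 <= t ->
    (forall x y, 0 <= w x y) -> (forall x y, 0 <= e x y) ->
  walk_weight (fun=> w) v s + t * \sum_(j < size s) walk_weight (step_at w e j) v s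
    <= walk_weight (fun _ x y => w x y + t * e x y) v s.
Proof.
move=> t0 w0 e0; elim: s v => [|u s IH] v /=; first by rewrite big_ord0 mulr0 addr0.
rewrite big_ord_recl /= {1 2}/step_at /=.
under eq_bigr => j _ do rewrite (@eq_walk_weight _ (step_at w e j)) //.
rewrite -mulr_sumr !(@eq_walk_weight ((fun=> w) \o S) (fun=> w)) //.
rewrite (@eq_walk_weight ((fun _ x y => w x y + t * e x y) \o S) (fun _ x y => w x y + t * e x y)) //.
have := IH u; set W := walk_weight (fun=> w) u s; set D := \sum_(j < _) _.
set W' := walk_weight _ u s => WD.
have D0 : 0 <= D.
  by apply: sumr_ge0 => j _; apply: walk_weight_ge0 => i x y; rewrite /step_at; case: eqP.
have h1 : (w v u + t * e v u) * (W + t * D) <= (w v u + t * e v u) * W'.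
  by rewrite ler_wpM2l // addr_ge0 // mulr_ge0.
apply: le_trans h1; rewrite -subr_ge0.
suff -> : (w v u + t * e v u) * (W + t * D) -
   (w v u * W + t * (e v u * W + w v u * D)) = t * e v u * (t * D).
  by rewrite !mulr_ge0.
by ring.
Qed.

Definition uniq_cycles_weight (k : nat) f := \sum_(s <- seqs k | uniq s) cycle_weight f s.

(** Rotating a list by one shifts the distinguished step by one position, so its place on the cycle
    is immaterial. *)
Lemma rot1_uniq_cycles_weight k (w e : V -> V -> R) j : (j.+1 < k)%N ->
  uniq_cycles_weight k (step_at w e j) = uniq_cycles_weight k (step_at w e j.+1).
Proof.
move=> jk; rewrite /uniq_cycles_weight.
rewrite (@reindex_seqs _ (rot 1)) ?size_rot //; [|exact: rot_inj|by move=> s; rewrite size_rot].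
rewrite big_seq_cond [RHS]big_seq_cond; apply: eq_big => [s|s]; first by rewrite rot_uniq.
rewrite mem_seqs => /andP[/eqP sk _]; move: sk jk.
case: s => [|x [|y s]]; [by move=> <-|by move=> <-|move=> <-].
rewrite rot1_cons rcons_cons /cycle_weight walk_weight_rcons last_rcons size_rcons.
rewrite rcons_cons [RHS]/= {2 3}/step_at /= => jk; rewrite gtn_eqF // mulrC.
congr (_ * _); apply: eq_walk_weight => i a b _; rewrite /step_at /= eqSS //.
Qed.

Lemma uniq_cycles_weight_step_at k (w e : V -> V -> R) j : (j < k)%N ->
  uniq_cycles_weight k (step_at w e j) = uniq_cycles_weight k (step_at w e 0).
Proof.
elim: j => // j IH jk; rewrite -rot1_uniq_cycles_weight // IH //.
exact: ltnW.
Qed.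

Lemma uniq_cycles_weight_perturb k (w e : V -> V -> R) t : 0 <= t ->
    (forall x y, 0 <= w x y) -> (forall x y, 0 <= e x y) -> (0 < k)%N ->
  uniq_cycles_weight k (fun=> w) + t * (k%:R * uniq_cycles_weight k (step_at w e 0))
    <= uniq_cycles_weight k (fun _ x y => w x y + t * e x y).
Proof.
move=> t0 w0 e0 k0.
have -> : k%:R * uniq_cycles_weight k (step_at w e 0) =
    \sum_(j < k) uniq_cycles_weight k (step_at w e j).
  under [RHS]eq_bigr => j _ do rewrite uniq_cycles_weight_step_at //.
  by rewrite sumr_const card_ord mulr_natl.
rewrite /uniq_cycles_weight exchange_big mulr_sumr -big_split /=.
rewrite big_seq_cond [X in _ <= X]big_seq_cond; apply: ler_sum => s.
rewrite mem_seqs => /andP[/eqP sk _]; move: k0; rewrite -sk; case: s sk => // x s sk _.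
by rewrite /= -(size_rcons s x) walk_weight_perturb.
Qed.

(* Up to a constant factor, the derivative of the weight of the cycles of length
   [l.+2] with respect to the weight of the edge [x y]. *)
Definition closing_weight l (w : V -> V -> R) x y :=
  \sum_(s <- seqs l | uniq [:: x, y & s]) walk_weight (fun=> w) y (rcons s x).

Lemma uniq_cycles_weight_first l (w e : V -> V -> R) :
  uniq_cycles_weight l.+2 (step_at w e 0) = \sum_x \sum_y e x y * closing_weight l w x y.
Proof.
rewrite /uniq_cycles_weight big_seqsS; apply: eq_bigr => x _.
by rewrite big_seqsS; apply: eq_bigr => y _; rewrite mulr_sumr.
Qed.

Lemma closing_weight_sym l w x y : (forall x y, w x y = w y x) ->
  closing_weight l w x y = closing_weight l w y x.
Proof.
move=> ws; rewrite /closing_weight.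
rewrite (@reindex_seqs _ rev) ?size_rev //; [|exact: (can_inj revK)|exact: size_rev].
apply: eq_big => [s|s _]; last by rewrite walk_weight_rev // revK.
by rewrite /= !inE !mem_rev rev_uniq [y == x]eq_sym !negb_or; case: (x == y); case: (x \in s); case: (y \in s).
Qed.

Lemma cycle_weight_rot (w : V -> V -> R) i s :
  cycle_weight (fun=> w) (rot i s) = cycle_weight (fun=> w) s.
Proof.
have [si|] := leqP (size s) i; first by rewrite rot_oversize.
elim: i => [|i IH] si; first by rewrite rot0.
rewrite rotS ?(ltnW si) // -[RHS]IH ?(ltnW si) //.
case: (rot i s) => [|x [|y t]] //.
rewrite rot1_cons rcons_cons /cycle_weight walk_weight_rcons last_rcons.
by rewrite rcons_cons /= mulrC.
Qed.

Lemma sum_ohead_rot s x : uniq s ->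
  (\sum_(i < size s) (ohead (rot i s) == Some x))%N = (x \in s).
Proof.
move=> us; have E (i : 'I_(size s)) : ohead (rot i s) = Some (nth x s i).
  by rewrite /rot (drop_nth x).
under eq_bigr => i _ do rewrite E.
have [xs|nxs] := boolP (x \in s); last first.
  rewrite big1 // => i _; case: eqP => // -[nx].
  by rewrite -nx mem_nth in nxs.
have xi : (index x s < size s)%N by rewrite index_mem.
rewrite (bigD1 (Ordinal xi)) //= nth_index // eqxx big1 // => i ii.
apply/eqP; rewrite eqb0; apply: contra ii => /eqP[nx].
by rewrite -val_eqE /= -[x in index x _]nx index_uniq.
Qed.

(** Double counting of cycles and rotations: a duplicate-free list through [x] has exactly one
    rotation with head [x]. *)
Lemma cycles_through k (w : V -> V -> R) x :
  \sum_(s <- seqs k | uniq s && (x \in s)) cycle_weight (fun=> w) s =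
  k%:R * \sum_(s <- seqs k | uniq s && (ohead s == Some x)) cycle_weight (fun=> w) s.
Proof.
have rotF (i : 'I_k) : \sum_(s <- seqs k | uniq s && (ohead s == Some x)) cycle_weight (fun=> w) s
    = \sum_(s <- seqs k | uniq s) cycle_weight (fun=> w) s *+ (ohead (rot i s) == Some x).
  rewrite (@reindex_seqs _ (rot i)) ?size_rot //; last 2 first.
  - exact: rot_inj.
  - by move=> s; rewrite size_rot.
  rewrite big_mkcondr /=; apply: eq_big => s; first by rewrite rot_uniq.
  by rewrite cycle_weight_rot; case: eqP.
have -> (a : R) : k%:R * a = \sum_(i < k) a by rewrite sumr_const card_ord mulr_natl.
rewrite [RHS](eq_bigr _ (fun i _ => rotF i)).
rewrite exchange_big /= big_mkcondr /= big_seq_cond [RHS]big_seq_cond.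
apply: eq_bigr => s; rewrite mem_seqs => /andP[/eqP sk us].
rewrite sumrMnr -sk sum_ohead_rot //.
by case: (x \in s).
Qed.

Lemma cycles_through_head l (w : V -> V -> R) x :
  \sum_(s <- seqs l.+2 | uniq s && (ohead s == Some x)) cycle_weight (fun=> w) s =
  \sum_y w x y * closing_weight l w x y.
Proof.
rewrite big_seqsS (bigD1 x) //= [X in _ + X]big1 ?addr0; last first.
  by move=> y yx; rewrite big1 // => s /andP[_ /eqP[xy]]; rewrite xy eqxx in yx.
rewrite big_seqsS; apply: eq_bigr => y _; rewrite mulr_sumr.
by apply: eq_bigl => s; rewrite /= eqxx andbT.
Qed.

(** Read backwards, a path that closes the edge from [x] to [y] is a walk from [x] ending at [y];
    summing over [y] frees that end. *)
Lemma sum_closing_weight l (w : V -> V -> R) x : (forall x y, w x y = w y x) ->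
  \sum_y closing_weight l w x y =
  \sum_(s <- seqs l.+1 | uniq (x :: s)) walk_weight (fun=> w) x s.
Proof.
move=> ws; rewrite (@reindex_seqs _ rev) ?size_rev //; last 2 first.
- exact: (can_inj revK).
- exact: size_rev.
rewrite big_seqsS; apply: eq_bigr => y _; apply: eq_big => s.
  by rewrite [RHS]/= rev_uniq mem_rev.
by rewrite walk_weight_rev // rev_cons.
Qed.

(** Ordered pairs are summed, so every edge counts twice; this explains the divisions by 2 below. *)
Definition inner_weight (w : V -> V -> R) (A : {set V}) := \sum_(x in A) \sum_(y in A) w x y.

(** The inequality of arithmetic and geometric means for [d] and [l] copies of [(e - d) / l%:R],
    whose sum is [e]. *)
Lemma AGM_step (d e : R) l : 0 <= d -> d <= e ->
  d * ((e - d) / l%:R) ^+ l <= (e / l.+1%:R) ^+ l.+1.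
Proof.
(* For [l = 0] the division by zero is harmless: the power is 1 and the claim is [d <= e]. *)
move=> d0 de; case: l => [|l]; first by rewrite expr0 mulr1 expr1 divr1.
pose F (i : 'I_l.+2) := if i == ord0 then d else (e - d) / l.+1%:R.
have F0 i : i \in predT -> 0 <= F i.
  by move=> _; rewrite /F; case: eqP => // _; rewrite divr_ge0 // subr_ge0.
have [] := leif_AGM (A := predT) F0; rewrite cardT size_enum_ord.
rewrite !big_ord_recl /F /= prodr_const sumr_const card_ord => h _.
rewrite exprS; apply: (le_trans h).
by rewrite -mulrS -[_ *+ l.+1]mulr_natr divfK ?pnatr_eq0 // addrC subrK.
Qed.

(** Induction on [l]. The first step leaves [x] for good, so the rest lives on [A :\ x], whose edge
    weight has lost the degree [d] of [x]; [AGM_step] recombines the two factors. *)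
Lemma walks_weight_le l (w : V -> V -> R) (A : {set V}) x :
    (forall x y, 0 <= w x y) -> (forall x y, w x y = w y x) -> x \in A ->
  \sum_(s <- seqs l | uniq (x :: s) && all (mem A) s) walk_weight (fun=> w) x s
    <= (inner_weight w A / 2 / l%:R) ^+ l.
Proof.
move=> w0 ws; elim: l x A => [|l IH] x A xA.
  by rewrite big_mkcond big_seq1 /= expr0.
rewrite big_seqsS.
pose d := \sum_(y in A :\ x) w x y.
have d0 : 0 <= d by apply: sumr_ge0.
(* Half of the loop weight [w x x] is all that is lost here. *)
have EA : d + inner_weight w (A :\ x) / 2 <= inner_weight w A / 2.
  rewrite [inner_weight w A]/inner_weight (big_setD1 x xA) /=.
  rewrite [\sum_(y in A) w x y](big_setD1 x xA) /= -/d.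
  have -> : \sum_(i in A :\ x) \sum_(y in A) w i y =
     d + inner_weight w (A :\ x).
    rewrite -big_split /=; apply: eq_bigr => i _; rewrite (big_setD1 x) //=.
    by rewrite ws.
  by have := w0 x x; lra.
have E0 : 0 <= inner_weight w (A :\ x) / 2.
  by rewrite divr_ge0 // sumr_ge0 // => i _; apply: sumr_ge0.
apply: (@le_trans _ _ (d * (inner_weight w (A :\ x) / 2 / l%:R) ^+ l)).
  rewrite mulr_suml [X in _ <= X]big_mkcond; apply: ler_sum => y _.
  case: ifPn => [yA|nyA]; last first.
    rewrite big1 // => s /andP[/= /andP[]]; rewrite !inE in nyA *.
    by rewrite eq_sym; case: eqP nyA => //= _ nyA _ _ /andP[yA]; rewrite yA in nyA.
  apply: le_trans (ler_wpM2l (w0 x y) (IH y (A :\ x) yA)).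
  rewrite mulr_sumr big_mkcond [X in _ <= X]big_mkcond; apply: ler_sum => s _.
  case: ifPn => [/andP[/= /andP[]]|_]; last first.
    by case: ifP => // _; rewrite mulr_ge0 // walk_weight_ge0.
  rewrite inE negb_or => /andP[xy xs] uys /andP[_ sA].
  rewrite ifT // uys /=; apply/allP => z zs; have zA : z \in A := allP sA z zs.
  by rewrite !inE zA andbT; apply: contraNneq xs => <-.
have -> : inner_weight w (A :\ x) / 2 = d + inner_weight w (A :\ x) / 2 - d by rewrite addrC addKr.
apply: le_trans (AGM_step _ d0 _) _; first by rewrite lerDl.
have dE0 : 0 <= d + inner_weight w (A :\ x) / 2 by rewrite addr_ge0.
have iS0 : (0 : R) <= l.+1%:R^-1 by rewrite invr_ge0.
apply: lerXn2r; rewrite ?nnegrE.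
- exact: mulr_ge0.
- by apply: mulr_ge0 => //; apply: le_trans EA.
- exact: ler_wpM2r.
Qed.

End Seqs.

(** * Dense graphs have clique minors *)

Section CliqueMinors.
Variable V : finType.
Implicit Types (r : rel V) (A S : {set V}).

Definition adj_in r A : rel V := [rel x y | [&& r x y, x \in A & y \in A]].

Definition connected_in r A :=
  forall x y, x \in A -> y \in A -> connect (adj_in r A) x y.

Definition nbrs r S x := [set y in S | r x y].

(* Each edge is counted twice. *)
Definition num_adj r S := \sum_(x in S) #|nbrs r S x|.

(** Branch sets are indexed by [nat], only the indices below [k] being constrained, so that a model
    is extended without changing the index type. *)
Definition clique_minor r S k := exists M : nat -> {set V},
  (forall i, i < k -> [/\ M i \subset S, M i != set0 & connected_in r (M i)]) /\
  (forall i j, i < k -> j < k -> i != j -> [disjoint M i & M j] /\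
     exists x y, [/\ x \in M i, y \in M j & r x y]).

(** The merged vertex keeps the name [x], while [y] remains in the type and is discarded by passing
    to [S :\ y]. *)
Definition contract r x y : rel V := [rel u v |
  (u != v) && [|| r u v, (u == x) && r y v | (v == x) && r u y]].

(** The singleton of [v] serves as the new branch set: every nonempty set of neighbours of [v] is
    joined to it. *)
Lemma clique_minor_cone r S k v : v \in S -> symmetric r -> irreflexive r ->
  clique_minor r (nbrs r S v) k -> clique_minor r S k.+1.
Proof.
move=> vS rs ri [M [M1 M2]].
have inM i x : i < k -> x \in M i -> (x \in S) && r v x.
  by move=> /M1[/subsetP MN _ _] /MN; rewrite inE.
exists (fun i => if i == k then [set v] else M i); split.
  move=> i ik1; case: eqP => [_|/eqP ik].
    split; rewrite ?sub1set //; first by apply/set0Pn; exists v; rewrite inE.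
    by move=> x y /set1P-> /set1P->.
  have ltik : i < k by rewrite ltn_neqAle ik -ltnS.
  have [_ M0 Mc] := M1 i ltik; split=> //; apply/subsetP => x /(inM _ _ ltik).
  by case/andP.
have link i : i < k -> [disjoint [set v] & M i] /\
   exists x y, [/\ x \in [set v], y \in M i & r x y].
  move=> ik; have [_ /set0Pn[x xM] _] := M1 i ik; split.
    rewrite disjoints1; apply/negP => /(inM _ _ ik).
    by rewrite ri andbF.
  by exists v, x; rewrite inE eqxx; have /andP[] := inM _ _ ik xM.
move=> i j ik jk ij.
have [ei|ni] := eqVneq i k; have [ej|nj] := eqVneq j k.
- by rewrite ei ej eqxx in ij.
- by apply: link; rewrite ltn_neqAle nj -ltnS.
- have [|d [x [y [xv yM rxy]]]] := link i; first by rewrite ltn_neqAle ni -ltnS.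
  by rewrite disjoint_sym; split=> //; exists y, x; rewrite rs.
- by apply: M2 => //; rewrite ltn_neqAle ?ni ?nj -ltnS.
Qed.

(** To undo the contraction, [y] is put back into the branch set that contains [x], if there is one;
    the edge [x y] keeps it connected. *)
Lemma clique_minor_contract r S k x y :
    symmetric r -> irreflexive r -> x \in S -> y \in S -> r x y ->
  clique_minor (contract r x y) (S :\ y) k -> clique_minor r S k.
Proof.
move=> rs ri xS yS rxy [M [M1 M2]].
pose M' i := if x \in M i then y |: M i else M i.
have sMM' i u : u \in M i -> u \in M' i.
  by rewrite /M'; case: ifP => // _ uM; rewrite !inE uM orbT.
have yM' i : x \in M i -> y \in M' i by rewrite /M' => ->; rewrite !inE eqxx.
have nyM i : i < k -> y \notin M i.
  by case/M1=> /subsetP MS _ _; apply/negP => /MS; rewrite !inE eqxx.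
exists M'; split => [i ik|i j ik jk ij]; last first.
  have [Mij [u [v [uM vM cuv]]]] := M2 i j ik jk ij; split; last first.
    case/andP: cuv => uv /or3P[ruv|/andP[/eqP ux ryv]|/andP[/eqP vx ruy]].
    - by exists u, v; rewrite !sMM'.
    - by exists y, v; split; [apply: yM'; rewrite -ux|apply: sMM'|].
    - by exists u, y; split; [apply: sMM'|apply: yM'; rewrite -vx|].
  have M'P l z : z \in M' l -> z \in M l \/ z = y /\ x \in M l.
    by rewrite /M'; case: ifP => xl; [rewrite !inE => /predU1P[]|]; auto.
  rewrite -setI_eq0; apply/eqP/setP => z; rewrite [RHS]inE; apply/negP.
  rewrite inE => /andP[/M'P[zi|[zy xi]] /M'P[zj|[zy' xj]]].
  - by rewrite (disjointFr Mij zi) in zj.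
  - by have := nyM i ik; rewrite -zy' zi.
  - by have := nyM j jk; rewrite -zy zj.
  - by rewrite (disjointFr Mij xi) in xj.
have [MS M0 Mc] := M1 i ik; split.
- apply/subsetP => z; rewrite /M'; have /subsetP MS' : M i \subset S by apply: subset_trans MS (subD1set _ _).
  by case: ifP => _; rewrite ?inE; [case/predU1P=> [->|/MS']|move/MS'].
- by case/set0Pn: M0 => z /sMM' zM; apply/set0Pn; exists z.
have cs : connect_sym (adj_in r (M' i)).
  by apply: sym_connect_sym => u v; rewrite /adj_in /= rs [(u \in _) && _]andbC.
(* A contracted edge inside a branch set lifts to the edge itself or to a detour through [y]. *)
have step u v : connect (adj_in (contract r x y) (M i)) u v -> connect (adj_in r (M' i)) u v.
  move: u v; apply: connect_sub => u v /= /and3P[/andP[uv h] uM vM].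
  case/or3P: h => [ruv|/andP[/eqP ux ryv]|/andP[/eqP vx ruy]].
  - by apply: connect1; rewrite /adj_in /= ruv !sMM'.
  - subst u; apply: (@connect_trans _ _ y); apply: connect1.
      by rewrite /adj_in /= rxy (sMM' _ _ uM) (yM' _ uM).
    by rewrite /adj_in /= ryv (yM' _ uM) (sMM' _ _ vM).
  - subst v; apply: (@connect_trans _ _ y); apply: connect1.
      by rewrite /adj_in /= ruy (sMM' _ _ uM) (yM' _ vM).
    by rewrite /adj_in /= rs rxy (yM' _ vM) (sMM' _ _ vM).
have back u : u \in M' i -> exists2 v, v \in M i & connect (adj_in r (M' i)) u v.
  rewrite {1}/M'; case: ifP => [xi|_ ui]; last by exists u.
  rewrite !inE => /predU1P[->|ui]; last by exists u.
  by exists x => //; apply: connect1; rewrite /adj_in /= rs rxy yM' // sMM'.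
move=> u v /back[u' u'M uu'] /back[v' v'M vv'].
apply: connect_trans uu' (connect_trans _ _); last by rewrite cs; exact: vv'.
by apply: step; apply: Mc.
Qed.

Lemma contract_sym r x y : symmetric r -> symmetric (contract r x y).
Proof.
move=> rs u v; rewrite /contract /= eq_sym rs [r y v]rs [r u y]rs.
by case: (v != u) (r v u) (u == x) (v == x) (r v y) (r y u) => [] [] [] [] [] [].
Qed.

Lemma contract_irr r x y : irreflexive (contract r x y).
Proof. by move=> u; rewrite /contract /= eqxx. Qed.

(** Contraction destroys the edge [x y] and merges two edges at every common neighbour; each loss
    counts twice in [num_adj]. *)
Lemma num_adj_contract r S x y : symmetric r -> irreflexive r ->
    x \in S -> y \in S -> r x y ->
  num_adj r S <= num_adj (contract r x y) (S :\ y) + 2 * #|nbrs r S x :&: nbrs r S y|.+1.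
Proof.
move=> rs ri xS yS rxy.
have xy : x != y by apply: contraTneq rxy => ->; rewrite ri.
set r' := contract r x y; set S' := S :\ y.
have xS' : x \in S' by rewrite !inE xy.
rewrite /num_adj (big_setD1 y) //= -/S' (big_setD1 x) //= [X in _ <= X + _](big_setD1 x) //=.
have main : #|nbrs r S y| + #|nbrs r S x| <= #|nbrs r' S' x| + #|nbrs r S x :&: nbrs r S y| + 2.
  have sub : (nbrs r S x :\ y) :|: (nbrs r S y :\ x) \subset nbrs r' S' x.
    apply/subsetP => w; rewrite !inE /r' /contract /= eqxx /= => /orP[/and3P[wy wS rxw]|/and3P[wx wS ryw]].
      rewrite wy wS rxw /= andbT; apply: contraTneq rxw => <-; by rewrite ri.
    have wy : w != y by apply: contraTneq ryw => ->; rewrite ri.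
    by rewrite wy wS ryw [x == w]eq_sym wx !orbT.
  have := subset_leq_card sub; rewrite cardsU.
  have -> : (nbrs r S x :\ y) :&: (nbrs r S y :\ x) = nbrs r S x :&: nbrs r S y.
    apply/setP => w; rewrite !inE; case: (eqVneq w y) => [->|]; first by rewrite ri !andbF.
    by case: (eqVneq w x) => [->|] //; rewrite ri !andbF.
  have := cardsD1 y (nbrs r S x); have := cardsD1 x (nbrs r S y).
  rewrite !inE xS yS rxy rs rxy /=.
  have : #|nbrs r S x :&: nbrs r S y| <= #|nbrs r S x :\ y|.
    apply: subset_leq_card; apply/subsetP => w; rewrite !inE => /and3P[/andP[-> ->] _ ryw].
    by rewrite !andbT; apply: contraTneq ryw => ->; rewrite ri.
  lia.
(* Any other row shrinks by at most one, and only at a common neighbour. *)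
have others : \sum_(u in S' :\ x) #|nbrs r S u| <=
    \sum_(u in S' :\ x) #|nbrs r' S' u| + #|nbrs r S x :&: nbrs r S y|.
  have -> : #|nbrs r S x :&: nbrs r S y| = \sum_(u in S' :\ x) (r x u && r y u).
    rewrite -sum1_card big_mkcond [RHS]big_mkcond; apply: eq_bigr => u _.
    rewrite !inE; case: (eqVneq u x) => [->|]; first by rewrite ri andbF.
    case: (eqVneq u y) => [->|]; first by rewrite ri !andbF.
    by case: (u \in S); case: (r x u); case: (r y u).
  rewrite -big_split leq_sum // => u; rewrite !inE => /and3P[ux uy uS] /=.
  have [ruy|nruy] := boolP (r u y); last first.
    rewrite [r y u]rs (negbTE nruy) andbF addn0; apply: subset_leq_card.
    apply/subsetP => w; rewrite !inE /r' /contract /= => /andP[-> ruw].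
    rewrite ruw /= !andbT; apply/andP; split; first by apply: contraNneq nruy => <-.
    by apply: contraTneq ruw => ->; rewrite ri.
  rewrite [r y u]rs ruy andbT [r x u]rs.
  have yN : y \in nbrs r S u by rewrite inE yS.
  rewrite (cardsD1 y) yN addnC.
  have [rux|nrux] := boolP (r u x) => /=.
    rewrite leq_add2r; apply: subset_leq_card; apply/subsetP => w.
    rewrite !inE /r' /contract /= => /and3P[-> -> ruw]; rewrite ruw /= andbT.
    by apply: contraTneq ruw => ->; rewrite ri.
  have xN : x \notin nbrs r S u :\ y by rewrite !inE (negbTE nrux) !andbF.
  have := cardsU1 x (nbrs r S u :\ y); rewrite xN addn0 addnC => <-.
  apply: subset_leq_card; apply/subsetP => w; rewrite !inE /r' /contract /=.
  case/predU1P => [->|/and3P[-> -> ruw]].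
    by rewrite xy xS eqxx ruy ux !orbT.
  by rewrite ruw /= andbT; apply: contraTneq ruw => ->; rewrite ri.
lia.
Qed.

(* Mader: contract an edge with few common neighbours; if there is none, the
   neighbourhood of a vertex is dense. *)
Theorem clique_minor_of_dense k r S : symmetric r -> irreflexive r -> S != set0 ->
  2 ^ k * #|S| <= num_adj r S -> clique_minor r S k.+1.
Proof.
elim: k r S => [|k IHk] r S rs ri S0 dense.
  (* A single vertex over the empty model. *)
  have [v vS] := set0Pn _ S0.
  apply: (@clique_minor_cone _ _ _ v) => //.
  by exists (fun=> set0); split=> // i j.
have [n] := ubnP #|S|; elim: n r S rs ri S0 dense => // n IHn r S rs ri S0 dense Sn.
have [/existsP[x /existsP[y /and4P[xS yS rxy few]]]|/existsPn all_many] :=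
  boolP [exists x, exists y, [&& x \in S, y \in S, r x y & #|nbrs r S x :&: nbrs r S y| < 2 ^ k]].
  (* With fewer than [2 ^ k] common neighbours the contraction loses at most [2 ^ k.+1] adjacencies,
     just what the removal of one vertex allows. *)
  apply: (@clique_minor_contract _ _ _ x y) => //.
  have xy : x != y by apply: contraTneq rxy => ->; rewrite ri.
  have cS : #|S| = #|S :\ y|.+1 by rewrite (cardsD1 y) yS.
  apply: IHn.
  - exact: contract_sym.
  - exact: contract_irr.
  - by apply/set0Pn; exists x; rewrite !inE xy.
  - have := num_adj_contract rs ri xS yS rxy; move: dense; rewrite cS expnS.
    by move: few; nia.
  - by rewrite -ltnS -cS.
(* Some vertex [v] is not isolated, and inside its neighbourhood all degrees are at least
   [2 ^ k]. *)
have : 0 < num_adj r S by apply: leq_trans dense; rewrite muln_gt0 expn_gt0 card_gt0.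
rewrite lt0n sum_nat_eq0 => /forallPn[v]; rewrite negb_imply => /andP[vS].
rewrite cards_eq0 => N0.
apply: (clique_minor_cone vS) => //; apply: IHk => //.
rewrite /num_adj mulnC -sum_nat_const leq_sum // => w; rewrite inE => /andP[wS rvw].
have /existsPn/(_ w) := all_many v; rewrite vS wS rvw /= -leqNgt => /leq_trans; apply.
by apply: subset_leq_card; apply/subsetP => z; rewrite !inE => /andP[-> /andP[_ ->]].
Qed.

End CliqueMinors.

(** * Long even cycles in a sparse graph *)

Section CycleLists.
Variable V : finType.
Implicit Types (s t : seq V) (e : rel V).

Definition rotations k (L : seq (seq V)) := [seq rotr i t | i <- iota 0 k.+1, t <- L].

Lemma mem_rotations k L i s : i <= k -> rot i s \in L -> s \in rotations k L.
Proof.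
move=> ik sL; apply/allpairsP; exists (i, rot i s); split=> //; last by rewrite rotK.
by rewrite mem_iota add0n ltnS.
Qed.

Lemma size_rotations k L : size (rotations k L) = k.+1 * size L.
Proof. by rewrite size_allpairs size_iota. Qed.

Lemma rot_to_lt s x : x \in s -> exists i t, i < size s /\ rot i s = x :: t.
Proof.
move=> xs; exists (index x s), (behead (rot (index x s) s)); rewrite index_mem xs.
by split=> //; rewrite /rot (drop_nth x) ?index_mem //= nth_index.
Qed.

(** The predecessor [z] of the failing pair is brought along because two consecutive light vertices
    are counted together with the neighbours on both sides. *)
Lemma cycle_failP e s : uniq s -> 2 < size s -> ~~ cycle e s ->
  exists i z x y t, [/\ i < size s, rot i s = [:: z, x, y & t] & ~~ e x y].
Proof.
move=> us s2 /negP nc.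
have [x xs nx] : exists2 x, x \in s & ~~ e x (next s x).
  have [/hasP[x]|] := boolP (has (fun x => ~~ e x (next s x)) s); first by exists x.
  by move/hasPn => h; case: nc; apply: cycle_from_next => // x /h; rewrite negbK.
have zs : prev s x \in s by rewrite mem_prev.
have [i [t [is_ st]]] := rot_to_lt zs.
have nz : next (prev s x :: t) (prev s x) = x by rewrite -st next_rot // next_prev.
have uz : uniq (prev s x :: t) by rewrite -st rot_uniq.
have sz : size (prev s x :: t) = size s by rewrite -st size_rot.
case: t st nz uz sz => [|x' [|y t]] st nz uz sz; rewrite -sz // in s2.
have x'E : x' = x by rewrite -nz /= eqxx.
exists i, (prev s x), x', y, t; split=> //; rewrite x'E in st uz *.
suff <- : next s x = y by [].
rewrite -(next_rot i us) st /= eqxx.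
by case: eqP uz => // <-; rewrite /= inE eqxx.
Qed.

Lemma count_le_size (P : pred (seq V)) k (L : seq (seq V)) :
  {in seqs V k, forall s, P s -> s \in L} -> count P (seqs V k) <= size L.
Proof.
move=> sub; rewrite -size_filter; apply: uniq_leq_size.
  by rewrite filter_uniq // seqs_uniq.
by move=> s; rewrite mem_filter => /andP[Ps sk]; apply: sub.
Qed.

Variable r : rel V.

Definition adj_pairs := [seq p <- enum {: V * V} | r p.1 p.2].

Lemma size_adj_pairs : size adj_pairs = num_adj r [set: V].
Proof.
rewrite size_filter -sum1_count big_enum_cond /=.
rewrite -(pair_big_dep xpredT (fun x y => r x y) (fun _ _ => 1)) /=.
rewrite /num_adj; apply: eq_big => [x|x _]; first by rewrite inE.
by rewrite -sum1_card; apply: eq_bigl => y; rewrite !inE.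
Qed.

(** Adjacency is imposed only inside successive pairs, so [j.*2] vertices cost [j] choices of an
    adjacent pair, hence O(n^j) in a sparse graph. *)
Fixpoint paired_walks j : seq (seq V) :=
  if j is j'.+1 then [seq p.1 :: p.2 :: s | p <- adj_pairs, s <- paired_walks j']
  else [:: [::]].

Lemma size_paired_walks j : size (paired_walks j) = size adj_pairs ^ j.
Proof. by elim: j => //= j IH; rewrite size_allpairs IH expnS. Qed.

Lemma mem_paired_walks j s : size s = j.*2 -> sorted r s -> s \in paired_walks j.
Proof.
elim: j s => [|j IH] [|x [|y s]] //= [sj] /andP[rxy ys].
apply/allpairsP; exists ((x, y), s); split=> //=; last by apply: IH => //; apply: path_sorted ys.
by rewrite mem_filter rxy mem_enum.
Qed.

End CycleLists.

(** * Heavy and light vertices on a long cycle *)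

Section CountCycles.
Variables (V : finType) (r : rel V) (C K m : nat).
Hypotheses (rs : symmetric r) (ri : irreflexive r).
Hypothesis sparse : forall S, num_adj r S <= C * #|S|.
Hypothesis common : forall x y z, uniq [:: x; y; z] ->
  #|[set v | [&& r v x, r v y & r v z]]| <= 2.
Hypothesis m2 : 1 < m.
Let n := #|V|.
Let deg x := #|nbrs r [set: V] x|.

Definition heavy := [set x | n < K * deg x].

Definition rich := [set x | (x \notin heavy) && (2 < #|nbrs r heavy x|)].

Lemma num_adjT : num_adj r setT <= C * n.
Proof. by rewrite /n -cardsT; apply: sparse. Qed.

(** Markov's inequality for the degrees, whose sum is at most [C * n]. *)
Lemma card_heavy : 0 < n -> #|heavy| <= K * C.
Proof.
move=> n0; rewrite -(leq_pmul2r n0).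
apply: (@leq_trans (\sum_(x in heavy) K * deg x)).
  by rewrite -sum_nat_const; apply: leq_sum => x; rewrite inE => /ltnW.
rewrite -big_distrr -mulnA leq_mul2l; apply/orP; right.
apply: leq_trans (_ : num_adj r setT <= _); last exact: num_adjT.
by rewrite /num_adj [leqRHS](big_setID heavy) /= setTI leq_addr.
Qed.

(** Every rich vertex is a common neighbour of some triple of distinct heavy vertices, and such a
    triple has at most two common neighbours. *)
Lemma card_rich : #|rich| <= 2 * #|heavy| ^ 3.
Proof.
pose triples := [seq t <- enum {: V * V * V} |
  [&& uniq [:: t.1.1; t.1.2; t.2], t.1.1 \in heavy, t.1.2 \in heavy & t.2 \in heavy]].
have size_triples : size triples <= #|heavy| ^ 3.
  rewrite size_filter -sum1_count big_enum_cond /=.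
  rewrite (_ : #|heavy| ^ 3 = #|setX (setX heavy heavy) heavy|); last by rewrite !cardsX !expnS expn0 muln1 mulnA.
  rewrite -sum1_card big_mkcond [leqRHS]big_mkcond leq_sum // => -[[x y] z] _ /=.
  by case: ifP => // /and4P[_ xB yB zB]; rewrite !in_setX /= xB yB zB.
have : \sum_(t <- triples) #|[set v | [&& r v t.1.1, r v t.1.2 & r v t.2]]| <= 2 * #|heavy| ^ 3.
  apply: (@leq_trans (\sum_(t <- triples) 2)).
    rewrite big_seq [leqRHS]big_seq; apply: leq_sum => t.
    by rewrite mem_filter => /andP[/and4P[ut _ _ _] _]; apply: common.
  by rewrite big_const_seq count_predT iter_addn_0 leq_mul2l.
apply: leq_trans.
have -> : \sum_(t <- triples) #|[set v | [&& r v t.1.1, r v t.1.2 & r v t.2]]| =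
    \sum_v count (fun t => [&& r v t.1.1, r v t.1.2 & r v t.2]) triples.
  under [RHS]eq_bigr do rewrite -sum1_count big_mkcond /=.
  rewrite exchange_big /=; apply: eq_bigr => t _; rewrite -sum1_card big_mkcond /=.
  by apply: eq_bigr => v _; rewrite inE.
rewrite -sum1_card big_mkcond leq_sum // => v _; case: ifP => //.
rewrite inE => /andP[_ /card_gt2P[x [y [z [[]]]]]].
rewrite !inE => /andP[xB vx] /andP[yB vy] /andP[zB vz] [xy yz zx].
rewrite -has_count; apply/hasP; exists (x, y, z); last by rewrite /= vx vy vz.
by rewrite mem_filter mem_enum /= !inE negb_or xy yz eq_sym zx xB yB zB.
Qed.

(* [min d e] counts the [i] below both, so this sums [num_adj] over level sets. *)
Lemma sum_min_deg : \sum_x \sum_(y | r x y) minn (deg x) (deg y) <= C * (C * n).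
Proof.
have degn x : deg x <= n by rewrite max_card.
pose L i := [set x | i < deg x].
have minE d e : d <= n -> minn d e = \sum_(i < n) ((i < d) && (i < e)).
  move=> dn; have -> : \sum_(i < n) ((i < d) && (i < e)) = \sum_(i < n) (i < minn d e).
    by apply: eq_bigr => i _; rewrite leq_min.
  rewrite -(big_mkord xpredT (fun i => (i < minn d e) : nat)).
  rewrite (@big_cat_nat _ _ _ (minn d e)) //=; last by rewrite geq_min dn.
  rewrite big_nat_cond (eq_bigr (fun=> 1)) => [|i /andP[/andP[_ ->]]] //.
  rewrite -big_nat_cond sum_nat_const_nat subn0 muln1.
  rewrite [X in _ = _ + X]big_nat_cond big1 ?addn0 // => i /andP[/andP[ge_i _] _].
  by rewrite ltnNge ge_i.
have -> : \sum_x \sum_(y | r x y) minn (deg x) (deg y) = \sum_(i < n) num_adj r (L i).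
  under eq_bigr => x _ do under eq_bigr => y _ do rewrite minE //.
  under eq_bigr => x _ do rewrite exchange_big /=.
  rewrite exchange_big; apply: eq_bigr => i _ /=.
  rewrite /num_adj [RHS]big_mkcond; apply: eq_bigr => x _; rewrite inE.
  rewrite big_mkcond /=; case: ltnP => _ /=; last first.
    by rewrite big1 // => y _; case: ifP.
  rewrite -sum1_card [RHS]big_mkcond; apply: eq_bigr => y _.
  by rewrite !inE; case: (r x y); case: (i < deg y).
apply: leq_trans (_ : \sum_(i < n) C * #|L i| <= _).
  by apply: leq_sum => i _; apply: sparse.
rewrite -big_distrr leq_mul2l; apply/orP; right.
apply: leq_trans (_ : num_adj r setT <= _); last exact: num_adjT.
rewrite /num_adj (eq_bigr (fun i : 'I_n => \sum_x (i < deg x))); last first.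
  move=> i _; rewrite -sum1_card big_mkcond /=; apply: eq_bigr => x _.
  by rewrite inE; case: ltnP.
rewrite exchange_big /=; apply: eq_leq; apply: eq_big => [x|x _]; first by rewrite inE.
rewrite -[RHS](minnn (deg x)) (minE _ _ (degn x)).
by apply: eq_bigr => i _; rewrite andbb.
Qed.

Definition small_paths := [seq s <- seqs V 4 |
  if s is [:: z; x; y; u] then
    [&& r z x, r x y, r y u, x \notin heavy & y \notin heavy] else false].

(** Two adjacent light vertices [x], [y] extend in [deg x * deg y] ways. The larger degree is at
    most n/K, and the smaller ones sum to O(n) by [sum_min_deg]. *)
Lemma size_small_paths : K * size small_paths <= n * (C * (C * n)).
Proof.
have -> : size small_paths =
    \sum_(x | x \notin heavy) \sum_(y | (y \notin heavy) && r x y) deg x * deg y.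
  rewrite size_filter -sum1_count big_mkcond big_seqsS.
  under eq_bigr => z _ do rewrite big_seqsS.
  under eq_bigr => z _ do under eq_bigr => x _ do rewrite big_seqsS.
  under eq_bigr => z _ do under eq_bigr => x _ do under eq_bigr => y _ do rewrite big_seqsS.
  under eq_bigr => z _ do under eq_bigr => x _ do under eq_bigr => y _ do
    under eq_bigr => u _ do rewrite big_seq1.
  rewrite exchange_big [RHS]big_mkcond; apply: eq_bigr => x _ /=.
  rewrite exchange_big /=; case: ifP => xB; last first.
    by rewrite big1 // => y _; rewrite big1 // => z _; rewrite big1 // => u _; rewrite !andbF.
  rewrite [RHS]big_mkcond; apply: eq_bigr => y _.
  case: ifP => [/andP[yB rxy]|nxy]; last first.
    rewrite big1 // => z _; rewrite big1 // => u _; case: ifP => // /and4P[_ rxy _ /= yB].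
    by rewrite yB rxy in nxy.
  rewrite /deg -[#|nbrs r setT x|]sum1_card -[#|nbrs r setT y|]sum1_card big_distrlr /=.
  rewrite [RHS]big_mkcond; apply: eq_bigr => z _.
  have nT x' y' : (y' \in nbrs r setT x') = r x' y' by rewrite !inE.
  rewrite nT rs; case: ifP => rzx; last by rewrite big1.
  rewrite [RHS]big_mkcond; apply: eq_bigr => u _.
  by rewrite nT rxy yB /= andbT.
rewrite big_distrr /= -(leq_add2r 0) !addn0.
apply: leq_trans (leq_mul (leqnn n) sum_min_deg).
rewrite big_distrr /= [leqLHS]big_mkcond; apply: leq_sum => x _; case: ifP => // xB.
rewrite !big_distrr /= [leqLHS]big_mkcond [leqRHS]big_mkcond; apply: leq_sum => y _.
case: ifP => [/andP[yB ->]|_]; last by case: ifP.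
move: xB yB; rewrite !inE -!leqNgt => xB yB.
by have [le_xy|/ltnW le_yx] := leqP (deg x) (deg y); nia.
Qed.

(** For [A] and [B] of size bounded in terms of [K], these two vertices cost a constant and the
    remaining ones [m.-1] edges: one power of [n] below the main term. *)
Definition pairs_then (A B : {set V}) :=
  [seq p.1 :: p.2 :: t | p <- enum (setX A B), t <- paired_walks r m.-1].

Lemma size_pairs_then A B :
  size (pairs_then A B) = #|A| * #|B| * size (adj_pairs r) ^ m.-1.
Proof. by rewrite size_allpairs size_paired_walks -cardE cardsX. Qed.

Lemma cycle_tail_walk x y t j : cycle r [:: x, y & t] -> size t = j.*2 ->
  t \in paired_walks r j.
Proof.
rewrite (cycle_path x) /= => /and3P[_ _ yt] tj; apply: mem_paired_walks => //.
exact: path_sorted yt.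
Qed.

Lemma mem_pairs_then (A B : {set V}) x y t : x \in A -> y \in B ->
  cycle r [:: x, y & t] -> size t = m.-1.*2 -> [:: x, y & t] \in pairs_then A B.
Proof.
move=> xA yB cyc tm; apply/allpairsP; exists ((x, y), t); split=> //=.
  by rewrite mem_enum inE xA.
exact: cycle_tail_walk cyc tm.
Qed.

(** The conditions on [b] and [b'] are built in so that the cardinalities form an edge weight on all
    of [V]. *)
Definition mids b b' := [set v | [&& b \in heavy, b' \in heavy, b != b', v \notin heavy,
  v \notin rich, r b v & r v b']].

Lemma mids_sym b b' : mids b b' = mids b' b.
Proof.
apply/setP => v; rewrite [LHS]in_set [RHS]in_set [b' == b]eq_sym [r b v]rs [r v b']rs.
by case: (b \in heavy); case: (b' \in heavy) => //=; rewrite [r v b && _]andbC.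
Qed.

Lemma midsxx b : mids b b = set0.
Proof. by apply/setP => v; rewrite !in_set eqxx !andbF. Qed.

(** A light vertex that is not rich has at most two heavy neighbours, hence lies in [mids b b'] for
    at most two ordered pairs. *)
Lemma total_mids : \sum_b \sum_b' #|mids b b'| <= n * 2.
Proof.
pose X v := nbrs r heavy v.
rewrite (_ : \sum_b _ = \sum_v \sum_b \sum_b' (v \in mids b b')); last first.
  rewrite [RHS]exchange_big; apply: eq_bigr => b _.
  rewrite [RHS]exchange_big; apply: eq_bigr => b' _ /=.
  by rewrite -sum1_card big_mkcond; apply: eq_bigr => v _; case: (v \in _).
rewrite -sum_nat_const [leqRHS]big_mkcond leq_sum // => v _.
have [/andP[vB vR]|vBR] := boolP ((v \notin heavy) && (v \notin rich)); last first.
  rewrite big1 // => b _; rewrite big1 // => b' _; apply/eqP; rewrite eqb0; apply: contra vBR.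
  by rewrite inE => /and5P[_ _ _ -> /andP[->]].
have X2 : #|X v| <= 2 by move: vR; rewrite inE vB -leqNgt.
have -> : \sum_b \sum_b' (v \in mids b b') = \sum_(b in X v) #|X v :\ b|.
  rewrite [RHS]big_mkcond; apply: eq_bigr => b _ /=.
  case: ifPn => [bX|bX]; last first.
    rewrite big1 // => b' _; apply/eqP; rewrite eqb0; apply: contra bX.
    by rewrite inE => /and5P[bB _ _ _ /and3P[_ rbv _]]; rewrite in_set bB rs.
  rewrite -sum1_card [RHS]big_mkcond; apply: eq_bigr => b' _ /=.
  have /andP[bB vb] : (b \in heavy) && r v b by move: bX; rewrite in_set.
  rewrite in_set bB vB vR rs vb in_setD1 eq_sym [b' \in X v]in_set /=.
  by case: (b' \in heavy); case: (b' != b); case: (r v b').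
have E b : b \in X v -> #|X v :\ b| = #|X v|.-1 by move=> bX; rewrite (cardsD1 b (X v)) bX.
by rewrite (eq_bigr _ E) sum_nat_const; case: #|X v| X2 => [|[|[|]]].
Qed.

Fixpoint choices_path v b : seq (seq V) :=
  if b is u :: b' then [seq c :: cs | c <- enum (mids v u), cs <- choices_path u b']
  else [:: [::]].

Definition choices b := if b is x :: b' then choices_path x (rcons b' x) else [:: [::]].

Fixpoint interleave (c b : seq V) :=
  match c, b with
  | c0 :: c', b0 :: b' => [:: c0, b0 & interleave c' b']
  | _, _ => [::]
  end.

(* [b0; c0; b1; c1; ...], obtained from the closed walk at [b0]. *)
Definition alternating_cycle b c :=
  if b is x :: b' then belast x (interleave c (rcons b' x)) else [::].

Definition alternating_cycles :=
  [seq alternating_cycle b c | b <- [seq b <- seqs V m | uniq b], c <- choices b].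

Lemma size_alternating_cycles :
  size alternating_cycles = \sum_(b <- seqs V m | uniq b) size (choices b).
Proof. by rewrite size_allpairs_dep sumnE big_map big_filter. Qed.

(** In the walk that follows a heavy start, the even positions hold the light vertices and the odd
    ones the heavy vertices. *)
Fixpoint evens (t : seq V) := if t is c :: u :: t' then c :: evens t' else [::].
Fixpoint odds (t : seq V) := if t is c :: u :: t' then u :: odds t' else [::].

Lemma even_ind (Q : seq V -> Prop) : Q [::] -> (forall c u t, Q t -> Q [:: c, u & t]) ->
  forall j t, size t = j.*2 -> Q t.
Proof.
by move=> Q0 Q2; elim=> [|j IH] [|c [|u t]] //= [tj]; apply: Q2; apply: IH.
Qed.

Lemma interleaveK j t : size t = j.*2 -> interleave (evens t) (odds t) = t.
Proof. by move: t; apply: even_ind => //= c u t ->. Qed.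

Lemma size_odds j t : size t = j.*2 -> size (odds t) = j.
Proof. by elim: j t => [|j IH] [|c [|u t]] //= [/IH ->]. Qed.

Lemma odds_rcons j t x : size t = j.*2.+1 -> odds (rcons t x) = rcons (odds t) x.
Proof. by elim: j t => [|j IH] [|c [|u t]] //= [tj]; rewrite IH. Qed.

Lemma odds_subseq t : subseq (odds t) t.
Proof.
have [k] := ubnP (size t); elim: k t => // k IH [|c [|u t]] // tk.
apply: (@subseq_trans _ (u :: t)); last exact: subseq_cons.
by rewrite /= eqxx; apply: IH; rewrite -ltnS ltnW.
Qed.

Let alt : rel V := [rel x y | (x \in heavy) != (y \in heavy)].
Let neq : rel V := [rel x y | x != y].

Lemma evens_choices j v t : size t = j.*2 -> v \in heavy -> path r v t -> path alt v t ->
  all (fun x => x \notin rich) t -> path neq v (odds t) -> evens t \in choices_path v (odds t).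
Proof.
elim: j v t => [|j IH] v [|c [|u t]] //= [tj] vB /and3P[vc cu ut] /and3P[avc acu aut].
move=> /and3P[nc nu nt] /andP[vu nut]; have {}vu : v != u := vu.
have cB : c \notin heavy by move: avc; rewrite /alt /= vB; case: (c \in heavy).
have uB : u \in heavy by move: acu; rewrite /alt /= (negbTE cB); case: (u \in heavy).
apply/allpairsP; exists (c, evens t); split=> //=; last exact: IH.
by rewrite mem_enum inE vB uB vu cB nc vc cu.
Qed.

Lemma uniq_path_neq x b : b != [::] -> uniq (x :: b) -> path neq x (rcons b x).
Proof.
case: b => // y b _ u; rewrite rcons_path.
have -> : path neq x (y :: b).
  by move: u; rewrite uniq_pairwise => /pairwise_sorted.
by rewrite /neq /=; apply: contraTneq u => xl; rewrite /= -{1}xl mem_last.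
Qed.

(** Appending the start [x] to the tail closes the walk, which then splits into [m] pairs made of a
    light and a heavy vertex. *)
Lemma mem_alternating_cycles s : size s = m.*2 -> uniq s -> cycle r s -> cycle alt s ->
  all (fun x => x \notin rich) s -> (if s is x :: _ then x \in heavy else false) ->
  s \in alternating_cycles.
Proof.
case: s => // x t sm us cs as_ ns xB.
have tm : size t = m.-1.*2.+1.
  by apply/eqP; rewrite -eqSS -[_.+1]/(size (x :: t)) sm -doubleS prednK // ltnW.
have txm : size (rcons t x) = m.*2 by rewrite size_rcons.
have odx := odds_rcons x tm.
have om : size (odds t) = m.-1.
  by apply/eqP; rewrite -eqSS -(size_rcons (odds t) x) -odx (size_odds txm) prednK // ltnW.
apply/allpairsPdep; exists (x :: odds t), (evens (rcons t x)); split.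
- have ux : uniq (x :: odds t).
    by apply: subseq_uniq us; rewrite /= eqxx odds_subseq.
  by rewrite mem_filter ux mem_seqs /= om prednK // ltnW.
- rewrite /= -odx; apply: (evens_choices txm) => //.
  + by move: ns; rewrite /= all_rcons => /andP[-> ->].
  + rewrite odx; apply: uniq_path_neq; last by apply: subseq_uniq us; rewrite /= eqxx odds_subseq.
    by rewrite -size_eq0 om -lt0n -subn1 subn_gt0.
- by rewrite /= -odx (interleaveK txm) belast_rcons.
Qed.

(** The factor [(m.*2).+1] pays for rotating the exceptional place to the front; the doubling pays
    for the two kinds of start, heavy or light, of an alternating list. *)
Theorem count_cycles_le :
  count (fun s => cycle r s && uniq s) (seqs V m.*2) <=
  (m.*2).+1 * (#|heavy| * #|heavy| * size (adj_pairs r) ^ m.-1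
     + size small_paths * size (adj_pairs r) ^ m.-2
     + #|rich| * #|heavy| * size (adj_pairs r) ^ m.-1)
  + (\sum_(b <- seqs V m | uniq b) size (choices b)).*2.
Proof.
rewrite -size_alternating_cycles -[(size alternating_cycles).*2]addnn !mulnDr -!size_pairs_then -size_paired_walks.
rewrite -(size_allpairs (fun q t => q ++ t)) -!size_rotations.
(* The second copy of [alternating_cycles], rotated by one, holds the lists that start at a light
   vertex. *)
rewrite -{2}(size_map (rotr 1) alternating_cycles) -!size_cat.
apply: count_le_size => s; rewrite mem_seqs => /eqP sm /andP[cs us].
rewrite mem_cat [X in X || _]mem_cat [X in (X || _) || _]mem_cat [X in _ || X]mem_cat.
have s2 : 2 < size s by move: m2; rewrite sm -muln2; lia.
have mE : m = m.-2.+2 by move: m2; case: (m) => [|[]].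
have rotc i : cycle r (rot i s) by rewrite rot_cycle.
(* Two consecutive heavy vertices. *)
have [cA|] := boolP (cycle (fun x y => ~~ ((x \in heavy) && (y \in heavy))) s); last first.
  case/(cycle_failP us s2) => i [z [x [y [t [is_ st]]]]]; rewrite negbK => /andP[xB yB].
  have st1 : rot i.+1 s = [:: x, y & rcons t z] by rewrite rotS // st rot1_cons.
  rewrite (@mem_rotations _ _ _ i.+1) ?orbT //; first by rewrite -sm.
  have := rotc i.+1; rewrite st1 => cyc; apply: mem_pairs_then => //.
  have : size (rot i.+1 s) = m.*2 by rewrite size_rot.
  by rewrite st1 /= -!muln2; move: m2; lia.
(* Two consecutive light vertices, taken with the neighbours [z] and [u] around them. *)
have [cB|] := boolP (cycle (fun x y => (x \in heavy) || (y \in heavy)) s); last first.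
  case/(cycle_failP us s2) => i [z [x [y [t [is_ st]]]]]; rewrite negb_or => /andP[xB yB].
  rewrite (_ : (s \in rotations _ [seq q ++ t | q <- small_paths, t <- _]) = true) ?orbT //.
  apply: (@mem_rotations _ _ _ i); first by rewrite -sm ltnW.
  have ss : size (rot i s) = m.*2 by rewrite size_rot.
  case: t st => [|u t] st; first by rewrite st mE in ss.
  have := rotc i; rewrite st => cyc.
  have /and4P[zx xy yu ut] : path r z [:: x, y, u & t].
    by move: cyc; rewrite (cycle_path z) /= => /and5P[_ -> -> ->].
  apply/allpairsP; exists ([:: z; x; y; u], t); split=> //=.
    by rewrite mem_filter mem_seqs /= zx xy yu xB yB.
  apply: mem_paired_walks; last exact: path_sorted ut.
  by move: ss; rewrite st /= -!muln2; move: m2; lia.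
have alts : cycle alt s.
  apply: cycle_from_next => // x xs; rewrite /alt /=.
  have := next_cycle cA xs; have := next_cycle cB xs.
  by case: (x \in heavy); case: (next s x \in heavy).
(* A rich vertex is light, so in an alternating cycle its successor is heavy. *)
have [/hasP[x xs xr]|nr] := boolP (has (mem rich) s).
  have {}xr : x \in rich := xr.
  rewrite (_ : (s \in rotations _ (pairs_then rich heavy)) = true) ?orbT //.
  have [i [t [is_ st]]] := rot_to_lt xs.
  apply: (@mem_rotations _ _ _ i); first by rewrite -sm ltnW.
  have ss : size (rot i s) = m.*2 by rewrite size_rot.
  case: t st => [|y t] st; first by rewrite st mE in ss.
  have := rotc i; rewrite st => cyc; apply: mem_pairs_then => //.
    have := alts; rewrite -(rot_cycle i) st (cycle_path x) /= => /and3P[_ + _].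
    rewrite /alt /=; move: xr; rewrite inE => /andP[/negbTE -> _].
    by case: (y \in heavy).
  by move: ss; rewrite st /= -!muln2; move: m2; lia.
rewrite -all_predC in nr.
case: s sm cs us {s2 rotc} cA cB alts nr => [|x [|y s]] sm cs us cA cB alts nr; [by rewrite mE in sm|by rewrite mE in sm|].
have [xB|nxB] := boolP (x \in heavy).
  by rewrite mem_alternating_cycles ?orbT.
have yB : y \in heavy.
  by have := alts; rewrite (cycle_path x) /= => /and3P[_ + _]; rewrite /alt /= (negbTE nxB); case: (y \in heavy).
rewrite (_ : (_ \in map (rotr 1) alternating_cycles) = true) ?orbT //.
apply/mapP; exists (rot 1 [:: x, y & s]); last by rewrite rotK.
apply: mem_alternating_cycles; rewrite ?size_rot ?rot_uniq ?rot_cycle //.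
by rewrite rot1_cons all_rcons; move: nr => /= /and3P[-> -> ->].
Qed.

End CountCycles.

(** * Copies of a cycle and lists of vertices *)

Definition adj (V : finType) (G : sgraph V) : rel V :=
  [rel x y | [set x; y] \in edges G].

Section CycleCopies.
Variables (V : finType) (k : nat).
Hypothesis k2 : 2 < k.
Implicit Types (l : seq V) (f : {ffun 'I_k -> V}).

Definition cycle_of l : {set V} * {set {set V}} :=
  ([set x in l], [set [set x; next l x] | x in l]).

Lemma cycle_of_rot i l : uniq l -> cycle_of (rot i l) = cycle_of l.
Proof.
move=> ul; congr (_, _); first by apply/setP => x; rewrite !inE mem_rot.
apply/setP => e; apply/imsetP/imsetP => -[x]; rewrite ?mem_rot => xl ->;
  by exists x; rewrite ?mem_rot ?next_rot.
Qed.

Lemma cycle_of_rev l : uniq l -> cycle_of (rev l) = cycle_of l.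
Proof.
move=> ul; congr (_, _); first by apply/setP => x; rewrite !inE mem_rev.
apply/setP => e; apply/imsetP/imsetP => -[x]; rewrite ?mem_rev => xl ->.
  by exists (prev l x); rewrite ?mem_prev // next_rev // next_prev // setUC.
by exists (next l x); rewrite ?mem_rev ?mem_next // next_rev // prev_next // setUC.
Qed.

(** This is what tells a cyclic order from its reversal. *)
Lemma next_neq_prev l x : uniq l -> 2 < size l -> x \in l -> next l x != prev l x.
Proof.
move=> ul sl xl; apply/eqP => np.
have : next l (next l x) = x by rewrite np next_prev.
case: (rot_to xl) => i s st; rewrite -!(next_rot i ul) st.
have : uniq (rot i l) by rewrite rot_uniq.
have : size (rot i l) = size l by rewrite size_rot.
rewrite st; case: s {st} => [|y [|z s]] /= sE; [by rewrite -sE in sl|by rewrite -sE in sl|].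
rewrite !inE !negb_or eqxx => /and4P[/and3P[xy xz _] _ _ _].
by rewrite eq_sym (negbTE xy) eqxx => zx; rewrite zx eqxx in xz.
Qed.

Lemma next_enum_ord (i : 'I_k) : next (enum 'I_k) i = ordS i.
Proof.
rewrite next_nth mem_enum index_enum_ord.
have szE := size_enum_ord k.
case E: (enum 'I_k) szE => [|y p] szE; first by exfalso; move: k2; rewrite -szE.
have yE : y = 0 :> nat.
  by rewrite -[y]/(nth y (y :: p) 0) -E nth_enum_ord // (ltn_trans _ k2).
apply: val_inj => /=.
have [ik|ik] := leqP k i.+1.
  have ki : i.+1 = k by apply/eqP; rewrite eqn_leq ik ltn_ord.
  have sp : size p <= i by rewrite -ltnS; exact: leq_trans (eq_leq szE) ik.
  by rewrite ki modnn nth_default.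
by rewrite -[nth y p i]/(nth y (y :: p) i.+1) -E nth_enum_ord // modn_small.
Qed.

Definition embeds (S : {set V} * {set {set V}}) f :=
  [&& injectiveb f, S.1 == f @: [set: 'I_k]
    & S.2 == [set f @: (e : {set 'I_k}) | e : {set 'I_k} in edges (cycle_graph k)]].

Lemma embeds_cycle_of S f : embeds S f -> uniq (codom f) /\ cycle_of (codom f) = S.
Proof.
case: S => S1 S2 /and3P[/= finj /eqP-> /eqP->]; split; first exact: finj.
have nextf i : next (codom f) (f i) = f (ordS i).
  by rewrite codomE next_map ?enum_uniq ?next_enum_ord //; apply/injectiveP.
congr (_, _).
  apply/setP => x; rewrite inE; apply/codomP/imsetP => [[i ->]|[i _ ->]]; last by exists i.
  by exists i => //; rewrite inE.
have ordS_neq (i : 'I_k) : i != ordS i.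
  rewrite -val_eqE /=; have [ik|ik] := leqP k i.+1.
    have ki : i.+1 = k by apply/eqP; rewrite eqn_leq ik ltn_ord.
    by rewrite ki modnn -lt0n -ltnS ki (ltn_trans _ k2).
  by rewrite modn_small // neq_ltn ltnSn.
have im2 i j : f @: [set i; j] = [set f i; f j] by rewrite imsetU !imset_set1.
apply/setP => e; apply/imsetP/imsetP => [[x /codomP[i ->]] ->|[e' ]].
  exists [set i; ordS i]; last by rewrite im2 nextf.
  by rewrite inE; apply/existsP; exists i; apply/existsP; exists (ordS i); rewrite ordS_neq !eqxx.
rewrite inE => /existsP[i /existsP[j /and3P[ij /eqP-> /eqP->]]] ->.
by exists (f i); rewrite ?codom_f // im2 nextf.
Qed.

(** Each copy yields [k.*2] distinct lists, by [k] rotations and two directions. *)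
Theorem num_copies_cycle_le (G : sgraph V) :
  num_copies G (cycle_graph k) * k.*2 <=
  count (fun s => cycle (adj G) s && uniq s) (seqs V k).
Proof.
pose l S := if [pick f | embeds S f] is Some f then codom f else [::].
pose copies := [set S | is_subgraph G S && iso_to S (cycle_graph k)].
have lP S : S \in copies -> [/\ uniq (l S), size (l S) = k, cycle (adj G) (l S) & cycle_of (l S) = S].
  rewrite inE => /andP[/andP[sub _] /existsP[f0 ef0]]; rewrite /l.
  case: pickP => [f ef|/(_ f0)]; last by rewrite /embeds ef0.
  have [uf fS] := embeds_cycle_of ef; split=> //; first by rewrite size_codom card_ord.
  apply: cycle_from_next => // x xf; apply: (subsetP sub).
  by rewrite -fS; apply/imsetP; exists x.
pose h (x : ({set V} * {set {set V}}) * ('I_k * bool)) :=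
  rot x.2.1 (if x.2.2 then l x.1 else rev (l x.1)).
have hS S i b : S \in copies -> cycle_of (h (S, (i, b))) = S.
  case/lP=> ul _ _ lS; rewrite /h /= -[RHS]lS; case: b.
    by rewrite cycle_of_rot.
  by rewrite cycle_of_rot ?rev_uniq // cycle_of_rev.
pose dom := setX copies [set: 'I_k * bool].
have -> : num_copies G (cycle_graph k) * k.*2 = size [seq h x | x <- enum dom].
  by rewrite size_map -cardE cardsX cardsT card_prod card_ord card_bool muln2.
rewrite -size_filter; apply: uniq_leq_size; last first.
  move=> s /mapP[[S [i b]]]; rewrite mem_enum in_setX /= => /andP[/lP[ul sl cl _] _] ->.
  rewrite mem_filter mem_seqs /h /= rot_uniq size_rot rot_cycle; case: b.
    by rewrite ul cl sl eqxx.
  have adjC : (fun z => adj G ^~ z) =2 adj G by move=> x y; rewrite /adj /= setUC.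
  by rewrite rev_uniq size_rev rev_cycle (eq_cycle adjC) ul sl cl eqxx.
rewrite map_inj_in_uniq ?enum_uniq // => -[S [i b]] [S' [i' b']].
rewrite !mem_enum !in_setX /= => /andP[SC _] /andP[SC' _] E.
have SS : S = S' by rewrite -(hS S i b SC) E hS.
move: E; rewrite -SS /h /=; have [ul sl _ _] := lP S SC.
have [x0 xl] : exists x, x \in l S.
  by case: (l S) sl => [|x s]; [move=> k0; move: k2; rewrite -k0|exists x; rewrite inE eqxx].
have rot_i (s : seq V) (j j' : 'I_k) : uniq s -> size s = k -> rot j s = rot j' s -> j = j'.
  move=> us sk e; apply: val_inj => /=; apply/eqP.
  have [js j's] : j < size s /\ j' < size s by rewrite sk.
  rewrite -(nth_uniq x0 js j's us).
  have hd (j0 : 'I_k) : nth x0 (rot j0 s) 0 = nth x0 s j0.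
    by rewrite /rot (drop_nth x0) // sk.
  by rewrite -!hd e.
(* Such an equality would make the successor of [x0] its predecessor. *)
have flip (j j' : 'I_k) : rot j (l S) <> rot j' (rev (l S)).
  move=> e; have := next_neq_prev ul _ xl; rewrite sl => /(_ k2) /eqP; apply.
  by rewrite -(next_rot j ul) e next_rot ?rev_uniq // next_rev.
case: b b' => [] [] // e.
- by rewrite (rot_i _ _ _ ul sl e).
- by case: (flip _ _ e).
- by case: (flip _ _ (esym e)).
- by rewrite (rot_i _ _ _ _ _ e) ?rev_uniq ?size_rev.
Qed.
End CycleCopies.

(** * The blow-up of a cycle *)

Section BlowUp.
Variables (n m : nat).
Hypothesis m2 : 2 < m.

(* The vertices below [m] form the cycle; a vertex [v >= m] subdivides the edge
   of the cycle that leaves the vertex [(v - m) %% m]. *)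
Definition layer (v : nat) := (v - m) %% m.
Definition level (v : nat) := (v - m) %/ m.

Definition hub_spoke : rel 'I_n := [rel b s : 'I_n |
  [&& b < m, m <= s & (b == layer s :> nat) || (b == (layer s).+1 %% m :> nat)]].

Definition cycle_blowup : sgraph 'I_n := graph_of_rel hub_spoke.

Lemma mem_cycle_blowup (e : {set 'I_n}) : e \in edges cycle_blowup ->
  exists b s : 'I_n, hub_spoke b s /\ e = [set b; s].
Proof.
by rewrite inE => /existsP[b /existsP[s /and3P[_ bs /eqP ->]]]; exists b, s.
Qed.

Lemma hub_spoke_edge (b s : 'I_n) : hub_spoke b s -> [set b; s] \in edges cycle_blowup.
Proof.
move=> bs; rewrite inE; apply/existsP; exists b; apply/existsP; exists s.
rewrite bs eqxx !andbT -val_eqE /= neq_ltn; case/and3P: bs => bm ms _.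
by rewrite (leq_trans bm ms).
Qed.

Let q := (n - m) %/ m.

Lemma layer_spoke c i : i < m -> layer (m + (c * m + i)) = i.
Proof. by move=> im; rewrite /layer addKn modnMDl modn_small. Qed.

Lemma level_spoke c i : i < m -> level (m + (c * m + i)) = c.
Proof. by move=> im; rewrite /level addKn divnMDl ?divn_small ?addn0 //; lia. Qed.

(** One copy for each choice [c] of a spoke in every layer: the even positions of the long cycle go
    to the hubs, the odd ones to the chosen spokes. *)
Lemma num_copies_blowup : q ^ m <= num_copies cycle_blowup (cycle_graph (2 * m)).
Proof.
have [q0|q0] := posnP q; first by rewrite q0 exp0n //; lia.
have mn : m + q * m <= n.
  have := leq_divM (n - m) m; rewrite -/q => h.
  have : m <= n by rewrite leqNgt; apply/negP => nm; move: q0; rewrite /q (_ : n - m = 0) ?div0n //; lia.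
  by lia.
have jm (j : 'I_(2 * m)) : j./2 < m by have := ltn_ord j; lia.
pose vtx (c : {ffun 'I_m -> 'I_q}) (j : 'I_(2 * m)) : nat :=
  if odd j then m + (c (Ordinal (jm j)) * m + j./2) else j./2.
have vtx_lt c j : vtx c j < n.
  rewrite /vtx; case: ifP => _; have := jm j; last by nia.
  by have := ltn_ord (c (Ordinal (jm j))); nia.
pose f c := [ffun j => Ordinal (vtx_lt c j)].
have fE c j : f c j = vtx c j :> nat by rewrite ffunE.
have f_inj c : injective (f c).
  move=> j j' /(congr1 val); rewrite /= !fE /vtx => e; apply: val_inj => /=.
  have := jm j; have := jm j'; move: e.
  case: ifP => oj; case: ifP => oj' e hj' hj; last by lia.
  - have := congr1 layer e; rewrite !layer_spoke //; lia.
  - by lia.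
  - by lia.
pose S c : {set 'I_n} * {set {set 'I_n}} := (f c @: [set: 'I_(2 * m)],
  [set f c @: (e : {set 'I_(2 * m)}) | e : {set 'I_(2 * m)} in edges (cycle_graph (2 * m))]).
(* The vertex set suffices: its spoke in layer [i] has level [c i]. *)
have S_inj : injective S.
  move=> c c' [E _]; apply/ffunP => i; apply: val_inj => /=.
  have i2 : i.*2.+1 < 2 * m by have := ltn_ord i; lia.
  have : f c (Ordinal i2) \in f c' @: [set: 'I_(2 * m)] by rewrite -E imset_f.
  case/imsetP => j _ /(congr1 val); rewrite /= !fE /vtx /= odd_double /=.
  have -> : Ordinal (jm (Ordinal i2)) = i by apply: val_inj => /=; lia.
  rewrite uphalf_double; case: ifP => oj e; last by have := jm j; lia.
  have := congr1 layer e; rewrite !layer_spoke // => ij.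
  have := congr1 level e; rewrite !level_spoke // => ->.
  by congr (nat_of_ord (c' _)); apply: val_inj.
have -> : q ^ m = #|[set S c | c : {ffun 'I_m -> 'I_q}]|.
  by rewrite card_imset // card_ffun !card_ord.
apply: subset_leq_card; apply/subsetP => _ /imsetP[c _ ->]; rewrite inE.
apply/andP; split; last first.
  apply/existsP; exists (f c); rewrite !eqxx !andbT.
  by apply/injectiveP.
rewrite /is_subgraph /=; apply/andP; split; apply/subsetP => _ /imsetP[e eC ->].
  move: eC; rewrite inE => /existsP[i /existsP[j /and3P[_ /eqP-> /eqP->]]].
  rewrite imsetU !imset_set1.
  have [i' i'D] : exists i', i' = ordS i by exists (ordS i).
  rewrite -i'D.
  (* The successor wraps around at [2 * m], which joins the spoke of the last layer to hub 0. *)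
  have i'E : i' = (if i.+1 == 2 * m then 0 else i.+1) :> nat.
    rewrite i'D /=; case: eqP => [->|ni]; first by rewrite modnn.
    by rewrite modn_small // ltn_neqAle ltn_ord andbT; apply/eqP.
  have := jm i; have := jm i'; have lt_i := ltn_ord i; rewrite {1}i'E => him' him.
  have [oi|ei] := boolP (odd i).
    have ei' : odd i' = false by rewrite i'E; case: eqP => _ //=; rewrite oi.
    rewrite setUC; apply: hub_spoke_edge; rewrite /hub_spoke /= !fE /vtx /= oi ei'.
    rewrite layer_spoke // i'E.
    have [iE|/eqP ni] := eqVneq i.+1 (2 * m).
      have -> : (i./2).+1 = m by lia.
      by rewrite modnn eqxx orbT andbT; lia.
    rewrite (@modn_small (i./2).+1); last by lia.
    by lia.
  have oi' : odd i' by rewrite i'E; case: eqP => ?; [lia|rewrite /= ei].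
  apply: hub_spoke_edge; rewrite /hub_spoke /= !fE /vtx /= (negbTE ei) oi' layer_spoke ?jm //.
  have ni : (i.+1 == 2 * m) = false by apply/eqP; lia.
  by rewrite leq_addr /= i'E ni; apply/orP; left; apply/eqP; lia.
by rewrite inE; apply: imsetS; apply/subsetP => j _; rewrite inE.
Qed.
End BlowUp.

(** * Crossing parity in the plane *)

Section CrossingParity.
Local Open Scope ring_scope.
Variables (R : realFieldType) (d : R).
Hypothesis d0 : 0 < d.
Implicit Types (D p q : R * R) (s t : seq (R * R)).

(* Half of the axis is included, so that exactly one of [D], [- D] is [upper]
   when [D != 0]. *)
Definition upper D := (0 < D.2) || ((D.2 == 0) && (0 < D.1)).

(** Testing the abscissa of [D] alone is enough: when two points near each other and far from the
    origin lie on different sides of the axis, their abscissas have the same sign. *)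
Definition crosses D D' := (upper D (+) upper D') && (0 < D.1).

Definition near_pt D D' := (`|D.1 - D'.1| <= d) && (`|D.2 - D'.2| <= d).

(** The factor 4 leaves room for two successive steps of size [d]. *)
Definition far_from0 D := (4 * d <= `|D.1|) || (4 * d <= `|D.2|).

Lemma upperN D : far_from0 D -> upper (- D) = ~~ upper D.
Proof.
rewrite /far_from0 /upper /=; move: D.1 D.2 => x y far.
case: (ltrgtP y 0) => hy; case: (ltrgtP x 0) => hx; rewrite ?oppr_gt0 ?oppr_eq0 //=;
  rewrite ?hx ?hy ?eqxx ?oppr_gt0 ?oppr0 ?ltxx ?(lt_gtF hx) ?(lt_gtF hy) ?(lt_eqF hy) ?(gt_eqF hy) //=.
by move: far; rewrite hx hy normr0; move: d0 => /[swap] /orP[] h; lra.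
Qed.

Lemma ler_dist2 (x y : R) : (`|x - y| <= d) = (x - y <= d) && (y - x <= d).
Proof. by rewrite ler_norml; apply/andP/andP => -[]; split; lra. Qed.

Lemma ler_norm2 (x : R) : (4 * d <= `|x|) = (4 * d <= x) || (x <= - (4 * d)).
Proof. by rewrite lerNr ler_normr. Qed.

Lemma upper_same_sign D D' : (0 < D.2) && (0 < D'.2) || (D.2 < 0) && (D'.2 < 0) ->
  upper D = upper D'.
Proof.
rewrite /upper; case/orP => /andP[h h'].
  by rewrite h h'.
by rewrite !(lt_gtF h, lt_gtF h', lt_eqF h, lt_eqF h').
Qed.

(** A short step that changes sides meets exactly one of the two opposite half-axes. *)
Lemma crossesN D D' : far_from0 D -> far_from0 D' -> near_pt D D' ->
  crosses D D' (+) crosses (- D) (- D') = upper D (+) upper D'.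
Proof.
move=> fD fD' nDD'; rewrite /crosses !upperN // addbN addNb negbK /= oppr_gt0.
case E: (upper D (+) upper D') => //=.
have: D.1 != 0.
  apply/eqP => x0.
  suff /upper_same_sign Eu: (0 < D.2) && (0 < D'.2) || (D.2 < 0) && (D'.2 < 0).
    by rewrite Eu addbb in E.
  move: fD nDD'; rewrite /far_from0 /near_pt x0 normr0 !ler_dist2 ler_norm2.
  have d0' := d0; move=> /orP[h|/orP[h|h]] /andP[_ /andP[]] h1 h2.
  - by exfalso; lra.
  - by apply/orP; left; apply/andP; split; lra.
  - by apply/orP; right; apply/andP; split; lra.
by case: ltrgtP.
Qed.

(** A small quadrilateral far from the origin does not wind around it, so it meets the ray an even
    number of times. *)
Lemma crosses_square D00 D10 D01 D11 :
    far_from0 D00 -> far_from0 D10 -> far_from0 D01 -> far_from0 D11 ->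
    near_pt D00 D10 -> near_pt D01 D11 -> near_pt D00 D01 -> near_pt D10 D11 ->
  crosses D00 D10 (+) crosses D01 D11 (+) crosses D00 D01 (+) crosses D10 D11
  = false.
Proof.
rewrite /near_pt !ler_dist2.
move=> f00 f10 f01 f11 /andP[/andP[? ?] /andP[? ?]] /andP[/andP[? ?] /andP[? ?]].
move=> /andP[/andP[? ?] /andP[? ?]] /andP[/andP[? ?] /andP[? ?]].
have d0' := d0; rewrite /crosses.
(* Either the abscissas involved all have the same sign, or the four points lie on one side of the
   axis. *)
have [hx|hx] := boolP ((3 * d <= D00.1) || (D00.1 <= - (3 * d))); last first.
  suff E : upper D00 = upper D10 /\ upper D00 = upper D01 /\ upper D00 = upper D11.
    by case: E => <- [<- <-]; rewrite addbb.
  have /orP[hy|hy] : (4 * d <= D00.2) || (D00.2 <= - (4 * d)).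
    move: f00 hx; rewrite /far_from0 !ler_norm2 negb_or -!ltNge.
    by move=> /orP[/orP[h|h]|//] /andP[h1 h2]; lra.
  - by split; last split; apply: upper_same_sign; apply/orP; left; apply/andP; split; lra.
  - by split; last split; apply: upper_same_sign; apply/orP; right; apply/andP; split; lra.
case/orP: hx => hx.
  have -> : 0 < D00.1 by lra.
  have -> : 0 < D10.1 by lra.
  have -> : 0 < D01.1 by lra.
  by rewrite !andbT; case: (upper D00) (upper D10) (upper D01) (upper D11) => [] [] [] [].
have h00 : D00.1 <= 0 by lra.
have h10 : D10.1 <= 0 by lra.
have h01 : D01.1 <= 0 by lra.
by rewrite !ltNge h00 h10 h01 !andbF.
Qed.

(* Number modulo 2 of crossings of the polygon [p :: s] with the horizontal
   ray issued from [q]. *)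
Fixpoint ray_crossings q p s : bool :=
  if s is p' :: s' then crosses (p - q) (p' - q) (+) ray_crossings q p' s'
  else false.

(** The negated differences amount to using the opposite ray. *)
Fixpoint ray_crossings_op q p s : bool :=
  if s is p' :: s' then crosses (q - p) (q - p') (+) ray_crossings_op q p' s'
  else false.

Lemma near_pt_sym p q : near_pt p q = near_pt q p.
Proof. by rewrite /near_pt distrC [X in _ && (X <= _)]distrC. Qed.

Lemma near_ptBr p p' q : near_pt (p - q) (p' - q) = near_pt p p'.
Proof. by rewrite /near_pt /= !opprB !addrA !subrK. Qed.

Lemma near_ptBl p q q' : near_pt (p - q) (p - q') = near_pt q q'.
Proof.
have E (x y z : R) : x - y - (x - z) = - (y - z).
  by rewrite opprB addrC subrKA opprB.
by rewrite /near_pt /= !E !normrN.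
Qed.

(** The sum of [crosses_square] along the polygon; the inner sides cancel. *)
Lemma ray_crossings_strip q q' p s : near_pt q q' -> path near_pt p s ->
    {in p :: s, forall x, far_from0 (x - q)} ->
    {in p :: s, forall x, far_from0 (x - q')} ->
  ray_crossings q p s (+) ray_crossings q' p s =
  crosses (p - q) (p - q') (+) crosses (last p s - q) (last p s - q').
Proof.
move=> qq'; elim: s p => [|p' s IH] p /=; first by rewrite addbb.
case/andP => pp' ps' fq fq'.
have {}IH := IH p' ps' (sub_in1 (fun x => _) fq) (sub_in1 (fun x => _) fq').
rewrite addbACA IH; last 2 first.
- by move=> x xs; rewrite inE xs orbT.
- by move=> x xs; rewrite inE xs orbT.
have in0 : p \in [:: p, p' & s] by rewrite inE eqxx.
have in1 : p' \in [:: p, p' & s] by rewrite !inE eqxx orbT.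
have /(_ _) := @crosses_square (p - q) (p' - q) (p - q') (p' - q')
  (fq _ in0) (fq _ in1) (fq' _ in0) (fq' _ in1).
rewrite !near_ptBr !near_ptBl => /(_ pp' pp' qq' qq').
by do 6 case: (crosses _ _).
Qed.

(** The differences of points of the two polygons form a grid that avoids the origin; adding up its
    strips leaves the crossings on its boundary. *)
Lemma ray_crossings_rect p s q t : path near_pt p s -> path near_pt q t ->
    {in p :: s & q :: t, forall x y, far_from0 (x - y)} ->
  ray_crossings q p s (+) ray_crossings (last q t) p s =
  ray_crossings_op p q t (+) ray_crossings_op (last p s) q t.
Proof.
move=> ps; elim: t q => [|q' t IH] q /=; first by rewrite addbb.
case/andP => qq' qt far.
have in0 : q \in [:: q, q' & t] by rewrite inE eqxx.
have in1 : q' \in [:: q, q' & t] by rewrite !inE eqxx orbT.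
have {}IH := IH q' qt.
rewrite addbACA -IH; last first.
  by move=> x y xs yt; apply: far => //; rewrite inE yt orbT.
rewrite -ray_crossings_strip //; last 2 first.
- by move=> x xs; apply: far.
- by move=> x xs; apply: far.
by do 3 case: (ray_crossings _ _ _).
Qed.

(** By [crossesN] the two opposite rays together record every change of side, and these changes
    telescope. *)
Lemma ray_crossings_opE p q t : path near_pt q t ->
    {in q :: t, forall y, far_from0 (p - y)} ->
  ray_crossings_op p q t = ray_crossings p q t (+) upper (q - p)
     (+) upper (last q t - p).
Proof.
elim: t q => [|q' t IH] q /=; first by rewrite addbb.
case/andP => qq' qt far.
have in0 : q \in [:: q, q' & t] by rewrite inE eqxx.
have in1 : q' \in [:: q, q' & t] by rewrite !inE eqxx orbT.
rewrite IH //; last by move=> y yt; apply: far; rewrite inE yt orbT.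
have := crossesN (far _ in0) (far _ in1).
rewrite near_ptBl => /(_ qq'); rewrite !opprB.
have := upperN (far _ in0); have := upperN (far _ in1); rewrite !opprB => -> ->.
by do 2 case: (crosses _ _); do 2 case: (upper _); do 2 case: (ray_crossings _ _ _);
  case: (upper _).
Qed.

Lemma ray_crossings_pair p s q t : path near_pt p s -> path near_pt q t ->
    {in p :: s & q :: t, forall x y, far_from0 (x - y)} ->
  ray_crossings q p s (+) ray_crossings (last q t) p s
  (+) ray_crossings p q t (+) ray_crossings (last p s) q t
  (+) upper (q - p) (+) upper (last q t - p)
  (+) upper (q - last p s) (+) upper (last q t - last p s) = false.
Proof.
move=> ps qt far; rewrite ray_crossings_rect // !ray_crossings_opE //.
- by do 2 case: (ray_crossings _ _ _); do 4 case: (upper _).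
- by move=> y yt; apply: far => //; apply: mem_last.
- by move=> y yt; apply: far => //; rewrite inE eqxx.
Qed.

End CrossingParity.

(** * A discrete form of the nonplanarity of K_{3,3} *)

Section K33.
Local Open Scope ring_scope.
Variables (R : realFieldType) (d : R).
Hypothesis d0 : 0 < d.
Variables (a b : 'I_3 -> R * R) (s : 'I_3 -> 'I_3 -> seq (R * R)).
Hypothesis path_s : forall i j, path (near_pt d) (a i) (s i j).
Hypothesis last_s : forall i j, last (a i) (s i j) = b j.
Hypothesis far_s : forall i j k l, i != k -> j != l ->
  {in a i :: s i j & a k :: s k l, forall x y, far_from0 d (x - y)}.

(** For fixed [i != k], the relation [E] is summed over the six ordered pairs [j != l]. A term that
    depends on only one of [j], [l] occurs twice and cancels, which leaves [U i], [U k] and an odd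
    contribution of the points [b]. So three booleans would differ pairwise. *)
Lemma discrete_K33_nonplanar : False.
Proof.
pose X i j q := ray_crossings q (a i) (s i j).
have E (i k j l : 'I_3) : i != k -> j != l ->
  X i j (a k) (+) X i j (b l) (+) X k l (a i) (+) X k l (b j)
  (+) upper (a k - a i) (+) upper (b l - a i)
  (+) upper (a k - b j) (+) upper (b l - b j) = false.
  move=> ik jl; have := ray_crossings_pair d0 (path_s i j) (path_s k l) (far_s ik jl).
  by rewrite !last_s.
have N (j l : 'I_3) : j != l -> upper (b l - b j) = ~~ upper (b j - b l).
  move=> jl; rewrite -(opprB (b j)) (upperN d0) //.
  have : b j \in a ord0 :: s ord0 j by rewrite -(last_s ord0 j) mem_last.
  have : b l \in a ord_max :: s ord_max l by rewrite -(last_s ord_max l) mem_last.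
  by move=> h2 h1; apply: (@far_s ord0 j ord_max l).
pose U i := \big[addb/false]_(j < 3) \big[addb/false]_(l < 3 | l != j) X i j (b l).
have const0 j c : \big[addb/false]_(l < 3 | l != j) c = false.
  by rewrite big_const cardC1 card_ord /= addbF addbb.
have exch (F : 'I_3 -> 'I_3 -> bool) :
    \big[addb/false]_(j < 3) \big[addb/false]_(l < 3 | l != j) F j l =
    \big[addb/false]_(l < 3) \big[addb/false]_(j < 3 | j != l) F j l.
  rewrite (exchange_big_dep xpredT) //=; apply: eq_bigr => l _.
  by apply: eq_bigl => j; rewrite eq_sym.
have UU i k : i != k -> U i (+) U k = true.
  move=> ik.
  have : \big[addb/false]_(j < 3) \big[addb/false]_(l < 3 | l != j) false = false.
    by rewrite big1 // => j _; rewrite const0.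
  have -> : \big[addb/false]_(j < 3) \big[addb/false]_(l < 3 | l != j) false =
    \big[addb/false]_(j < 3) \big[addb/false]_(l < 3 | l != j)
     (X i j (a k) (+) X i j (b l) (+) X k l (a i) (+) X k l (b j)
  (+) upper (a k - a i) (+) upper (b l - a i)
  (+) upper (a k - b j) (+) upper (b l - b j)).
    by apply: eq_bigr => j _; apply: eq_bigr => l; rewrite eq_sym => jl; rewrite E.
  under eq_bigr do rewrite !big_split /= !const0 addFb !addbF.
  rewrite !big_split /=.
  have -> : \big[addb/false]_(j < 3) \big[addb/false]_(l < 3 | l != j) X k l (a i) = false.
    by rewrite exch big1 // => l _; rewrite const0.
  have -> : \big[addb/false]_(j < 3) \big[addb/false]_(l < 3 | l != j) upper (b l - a i) = false.
    by rewrite exch big1 // => l _; rewrite const0.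
  have -> : \big[addb/false]_(j < 3) \big[addb/false]_(l < 3 | l != j) X k l (b j) = U k.
    by rewrite exch.
  (* Besides [U i] and [U k] there remains, by [N], one crossing for each of the three pairs of
     points [b]. *)
  rewrite !addbF -/(U i) => H; rewrite -[LHS]addbF -H addbA addbb addFb.
  rewrite !big_ord_recl !big_ord0 /=.
  do 3 rewrite big_mkcond /= !big_ord_recl big_ord0 /=.
  rewrite (N ord0 (lift ord0 ord0)) // (N ord0 (lift ord0 (lift ord0 ord0))) //.
  rewrite (N (lift ord0 ord0) (lift ord0 (lift ord0 ord0))) //.
  by do 3 case: (upper _).
have := UU ord0 ord_max isT; have := UU ord0 (inord 1); have := UU (inord 1) ord_max.
rewrite -!val_eqE /= inordK // => /(_ isT) + /(_ isT).
by case: (U _); case: (U _); case: (U _).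
Qed.
End K33.

From mathcomp Require Import all_classical all_reals all_analysis.
Import numFieldNormedType.Exports.
Local Open Scope ring_scope.

(** * Plane drawings *)

Section Arcs.
Local Open Scope classical_set_scope.
Local Open Scope ring_scope.
Variable R : realType.
Implicit Types f g : R -> R * R.

Lemma arc_continuous_at f x e : {within `[0, 1], continuous f} ->
    x \in `[0, 1] -> 0 < e ->
  exists2 r : R, 0 < r & forall y, y \in `[0, 1] -> `|x - y| < r ->
    `|(f x).1 - (f y).1| < e /\ `|(f x).2 - (f y).2| < e.
Proof.
move=> /subspace_continuousP /(_ x) cf x01 e0.
have /cf /(_ (ball (f x) e) (nbhsx_ballx _ _ e0)) : `[0, 1]%classic x by [].

rewrite /= /within /= => /nbhs_ballP[r r0 rf]; exists r => // y y01 xy.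
by have [] := rf y xy y01.
Qed.

(** Uniform continuity on the compact interval, followed by sampling at the multiples of
    [n.+1%:R^-1]. *)
Lemma arc_chain f d : {within `[0, 1], continuous f} -> 0 < d ->
  exists s : seq (R * R), [/\ path (near_pt d) (f 0) s, last (f 0) s = f 1
    & {in f 0 :: s, forall p, exists2 t, t \in `[0, 1] & p = f t}].
Proof.
move=> cf d0.
have : \forall n \near \oo, (`[0, 1]%classic `<=` [set x | forall y,
    y \in `[0, 1] -> `|x - y| <= n.+1%:R^-1 -> near_pt d (f x) (f y)%R]).
  have /compact_near_coveringP/near_covering_withinP := @segment_compact R 0 1.
  apply => x x01.
  have [|r r0 fr] := arc_continuous_at (e := d / 2) cf x01; first by rewrite divr_gt0.
  have r20 : 0 < r / 2 by rewrite divr_gt0.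
  near=> x' n => /= x'01 y y01 yx'.
  have xx' : `|x - x'| < r / 2 by near: x'; apply: nbhsx_ballx.
  have nr : n.+1%:R^-1 < r / 2 by near: n; exact: (near_infty_natSinv_lt (PosNum r20)).
  have [|h1 h2] := fr x' x'01; first by rewrite (lt_trans xx') // ltr_pdivrMr ?ltr_pMr ?ltr1n.
  have [|h3 h4] := fr y y01.
    by rewrite -(subrK x' x) -addrA (le_lt_trans (ler_normD _ _)) // [r]splitr ltrD // (le_lt_trans yx').
  rewrite /near_pt; apply/andP; split.
    rewrite -(subrK (f x).1 (f x').1) -addrA (le_trans (ler_normD _ _)) //.
    rewrite distrC; lra.
  rewrite -(subrK (f x).2 (f x').2) -addrA (le_trans (ler_normD _ _)) //.
  rewrite distrC; lra.
case=> n _ /(_ n (leqnn n)) fn.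
pose t k : R := k%:R / n.+1%:R.
have t01 k : (k <= n.+1)%N -> t k \in `[0, 1].
  by move=> kn; rewrite in_itv /= divr_ge0 //= ler_pdivrMr ?ltr0n // mul1r ler_nat.
have step k : (k < n.+1)%N -> near_pt d (f (t k)) (f (t k.+1)).
  move=> kn; apply: fn; [exact: (t01 _ (ltnW kn))|exact: t01|].
  by rewrite /t -mulrBl normrM distrC -natrB // subSnn normr1 mul1r ger0_norm.
have chain m k : (k + m <= n.+1)%N -> exists s : seq (R * R),
    [/\ path (near_pt d) (f (t k)) s, last (f (t k)) s = f (t (k + m)%N)
    & {in f (t k) :: s, forall p, exists2 t, t \in `[0, 1] & p = f t}].
  elim: m k => [|m IH] k kn.
    exists [::]; rewrite addn0; split => // p; rewrite inE => /eqP ->.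
    by exists (t k) => //; rewrite t01 // -(addn0 k).
  have [|s [ps ls fs]] := IH k.+1; first by rewrite addSnnS.
  exists (f (t k.+1) :: s); rewrite -addSnnS /=; split => //.
    by rewrite ps andbT step // -addn1 (leq_trans _ kn) // leq_add2l.
  move=> p; rewrite inE => /predU1P[->|/fs //].
  by exists (t k) => //; rewrite t01 // (leq_trans _ kn) // leq_addr.
have [s [ps ls fs]] := chain n.+1 0%N (leqnn _).
exists s; move: ps ls fs; rewrite /t add0n mul0r divff ?pnatr_eq0 //.
Unshelve. all: by end_near. Qed.

(** Disjoint compact arcs are a positive distance apart; the division by 4 offsets the factor in
    [far_from0]. *)
Lemma arc_far f g : {within `[0, 1], continuous f} ->
    {within `[0, 1], continuous g} ->
    (forall x y, x \in `[0, 1] -> y \in `[0, 1] -> f x <> g y) ->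
  \forall n \near \oo, forall x y, x \in `[0, 1] -> y \in `[0, 1] ->
    far_from0 (n.+1%:R^-1 / 4) (f x - g y).
Proof.
move=> cf cg fg.
have : \forall n \near \oo, (`[0, 1]%classic `<=` [set x | forall y,
    y \in `[0, 1] -> far_from0 (n.+1%:R^-1 / 4) (f x - g y)]).
  have /compact_near_coveringP/near_covering_withinP := @segment_compact R 0 1.
  apply => x x01.
  have gcl : closed (g @` `[0, 1]).
    apply: compact_closed; first exact: norm_hausdorff.
    by apply: continuous_compact => //; exact: segment_compact.
  have : (~` (g @` `[0, 1])) (f x).
    by move=> [y y01 /esym]; exact: fg.
  move=> /(conj (closed_openC gcl)) /open_nbhs_nbhs /nbhs_ballP[r /= r0 fr].
  have r20 : 0 < r / 2 by rewrite divr_gt0.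
  have [q q0 fq] := arc_continuous_at cf x01 r20.
  near=> x' n => /= x'01 y y01.
  have nr : n.+1%:R^-1 < r / 2 by near: n; exact: (near_infty_natSinv_lt (PosNum r20)).
  have [|h1 h2] := fq x' x'01; first by near: x'; apply: nbhsx_ballx.
  have far : ~ (`|(f x).1 - (g y).1| < r /\ `|(f x).2 - (g y).2| < r).
    by move=> fxy; apply: (fr (g y)); [exact: fxy|exists y].
  rewrite /far_from0 [_ / 4]mulrC mulrA divff // mul1r.
  apply: contraT; rewrite negb_or -!ltNge => /andP[h3 h4]; case: far; split.
    rewrite -(subrK (f x').1 (f x).1) -addrA (le_lt_trans (ler_normD _ _)) //.
    by rewrite [r]splitr ltrD // (lt_trans h3).
  rewrite -(subrK (f x').2 (f x).2) -addrA (le_lt_trans (ler_normD _ _)) //.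
  by rewrite [r]splitr ltrD // (lt_trans h4).
by apply: filterS => n fn x y x01 y01; apply: fn.
Unshelve. all: by end_near. Qed.
End Arcs.

(** * Planar graphs have no K_{3,3}-minor *)

Definition K33_minor (V : finType) (r : rel V) (A B : 'I_3 -> {set V}) :=
  [/\ forall i, connected_in r (A i) /\ connected_in r (B i),
      forall i j, i != j -> [disjoint A i & A j] /\ [disjoint B i & B j],
      forall i j, [disjoint A i & B j]
    & forall i j, exists x y, [/\ x \in A i, y \in B j & r x y]].

Section PlanarNoK33.
Variables (R : realType) (V : finType) (G : sgraph V).

Lemma adj_neq x y : adj G x y -> x != y.
Proof.
rewrite /adj /=; case: G => E /forallP H /= xy.
have /implyP/(_ xy) := H [set x; y]%SET; apply: contraTneq.
by move=> <-; rewrite finset.setUid cards1.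
Qed.

Lemma adj_sym : symmetric (adj G).
Proof. by move=> x y; rewrite /adj /= finset.setUC. Qed.

(** The conditions on a drawing concern open arcs; at their ends, the injectivity of [pos] and the
    disjointness of [e] and [e'] take over. *)
Lemma disjoint_arcs pos arc (e e' : {set V}) t t' :
    plane_drawing G pos arc -> e \in edges G -> e' \in edges G ->
    [disjoint e & e'] -> t \in `[0, 1] -> t' \in `[0, 1] ->
  arc e t <> arc e' t' :> R * R.
Proof.
case=> inj arcE arcV arcA eG e'G ee' t01 t'01.
have split01 (u : R) : u \in `[0, 1] -> [\/ u = 0, u = 1 | u \in `]0, 1[].
  rewrite !in_itv /= => /andP[]; rewrite !le_eqVlt.
  move=> /orP[/eqP <-|u0]; first by constructor 1.
  by move=> /orP[/eqP ->|u1]; [constructor 2|constructor 3; rewrite u0].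
have ends f u : f \in edges G -> u \in `[0, 1] ->
    (exists2 x, x \in f & arc f u = pos x) \/ u \in `]0, 1[.
  move=> fG /split01; case: (arcE f fG) => _ _ [x [y [-> h0 h1]]].
  case=> [->|->|->]; [left|left|by right].
    by exists x => //; rewrite !inE eqxx.
  by exists y => //; rewrite !inE eqxx orbT.
have nee' x : x \in e -> x \in e' -> False.
  by move=> xe; rewrite (disjointFr ee').
have [[x xe ->]|ti] := ends _ _ eG t01; have [[x' x'e' E]|ti'] := ends _ _ e'G t'01.
- by rewrite E => /inj xx'; apply: (nee' x) => //; rewrite xx'.
- by move=> /esym; apply: arcV.
- by rewrite E; apply: arcV.
- apply: arcA => //; apply/eqP => E; case: (arcE e eG) => _ _ [x [y [exy _ _]]].
  by apply: (nee' x); rewrite -?E exy !inE eqxx.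
Qed.

(** As there are finitely many pairs of edges, one [d] serves them all. *)
Lemma planar_chains : planar R G ->
  exists d (pos : V -> R * R) (arcs : {set V} -> set (R * R)),
  [/\ 0 < d,
      forall x y, adj G x y -> exists s, [/\ path (near_pt d) (pos x) s,
        last (pos x) s = pos y & {in pos x :: s, forall p, arcs [set x; y]%SET p}]
    & forall e e' p q, e \in edges G -> e' \in edges G -> [disjoint e & e'] ->
       arcs e p -> arcs e' q -> far_from0 d (p - q)].
Proof.
move=> [pos [arc D]]; have [inj arcE arcV arcA] := D.
have : \forall n \near \oo%classic, forall ee : {set V} * {set V},
    ee.1 \in edges G -> ee.2 \in edges G -> [disjoint ee.1 & ee.2] ->
    forall x y, x \in `[0, 1] -> y \in `[0, 1] ->
    far_from0 (n.+1%:R^-1 / 4) (arc ee.1 x - arc ee.2 y).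
  apply: filter_forall => -[e e'] /=.
  have [eG|] := boolP (e \in edges G); last by move=> _; apply: nearW.
  have [e'G|] := boolP (e' \in edges G); last by move=> _; apply: nearW.
  have [ee'|] := boolP [disjoint e & e']; last by move=> _; apply: nearW.
  have [[ce _ _] [ce' _ _]] := (arcE e eG, arcE e' e'G).
  have := arc_far ce ce' (fun x y => @disjoint_arcs _ _ _ _ x y D eG e'G ee').
  by apply: filterS => n H _ _ _.
case=> n _ /(_ n (leqnn n)) far.
exists (n.+1%:R^-1 / 4), pos, (fun e => arc e @` `[0, 1])%classic%classic.
have d0 : 0 < n.+1%:R^-1 / 4 :> R by rewrite divr_gt0 // invr_gt0 ltr0n.
split => // [x y xy|e e' _ _ eG e'G ee' [t t01 <-] [t' t'01 <-]]; last first.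
  exact: (far (e, e')).
have [ce _ [u [v [uv p0 p1]]]] := arcE _ xy.
have [s [ps ls fs]] := arc_chain ce d0.
have {}fs : {in pos u :: s, forall p, (arc [set x; y]%SET @` `[0, 1]%classic)%classic p}.
  by rewrite -p0 => p /fs[t t01 ->]; exists t.
rewrite p0 in ps ls; rewrite p1 in ls.
have : x \in [set u; v]%SET by rewrite -uv !inE eqxx.
have : y \in [set u; v]%SET by rewrite -uv !inE eqxx orbT.
have := adj_neq xy; rewrite !inE => nxy /orP[] /eqP yE /orP[] /eqP xE.
- by rewrite xE yE eqxx in nxy.
(* The arc is drawn from [y] to [x], so its chain is reversed. *)
- exists (rev (belast (pos u) s)); rewrite xE yE -ls rev_path; split.
  + by apply: sub_path ps => p q; rewrite near_pt_sym.
  + by case: (s) => //= p s'; rewrite rev_cons last_rcons.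
  + move=> p; rewrite -rev_rcons mem_rev -lastI => /fs.
    by rewrite xE yE.
- by exists s; rewrite xE yE in fs *.
- by rewrite xE yE eqxx in nxy.
Unshelve. all: by end_near. Qed.

Lemma adj_in_path (A : {set V}) x p : path (adj_in (adj G) A) x p ->
  path (adj G) x p /\ {subset p <= A}.
Proof.
elim: p x => //= y p IH x /andP[/and3P[xy xA yA] /IH[-> pA]]; rewrite xy.
by split=> // z; rewrite inE => /predU1P[->|/pA].
Qed.

(** A walk from [a i] to [b j] inside [A i :|: B j] becomes a chain of points along its edges. When
    [i != k] and [j != l], the two sets are disjoint, so the chains stay apart and
    [discrete_K33_nonplanar] applies. *)
Theorem planar_no_K33_minor (A B : 'I_3 -> {set V}) :
  planar R G -> ~ K33_minor (adj G) A B.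
Proof.
case/planar_chains => d [pos [arcs [d0 chain far]]] [conn disj AB link].
have A_ne i : exists x, x \in A i by have [x [y []]] := link i ord0; exists x.
have B_ne j : exists y, y \in B j by have [x [y []]] := link ord0 j; exists y.
pose a i := xchoose (A_ne i); pose b j := xchoose (B_ne j).
have aA i : a i \in A i := xchooseP (A_ne i).
have bB j : b j \in B j := xchooseP (B_ne j).
have walk i j : exists p, [/\ path (adj G) (a i) p, last (a i) p = b j, p != [::]
    & {subset a i :: p <= A i :|: B j}].
  have [x [y [xA yB xy]]] := link i j.
  have [[cA _] [_ cB]] := (conn i, conn j).
  have /connectP[p /adj_in_path[pp pA] pl] := cA _ _ (aA i) xA.
  have /connectP[q /adj_in_path[qp qB] ql] := cB _ _ yB (bB j).
  exists (p ++ y :: q); rewrite cat_path last_cat /= -pl pp xy qp -ql.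
  split => //; first by case: (p).
  move=> z; rewrite inE mem_cat inE.
  by case/or4P => [/eqP->|/pA zA|/eqP->|/qB zB]; rewrite finset.in_setU ?aA ?yB ?zA ?zB ?orbT.
pose on_arc (S : {set V}) z := exists e, [/\ e \in edges G, e \subset S & arcs e z].
have chains x p (S : {set V}) : path (adj G) x p -> p != [::] -> {subset x :: p <= S} ->
    exists s, [/\ path (near_pt d) (pos x) s, last (pos x) s = pos (last x p)
      & {in pos x :: s, forall z, on_arc S z}].
  elim: p x => //= y p IH x /andP[xy py] _ pS.
  have [s [ps ls fs]] := chain _ _ xy.
  have xyS : [set x; y]%SET \subset S.
    by apply/fintype.subsetP => z; rewrite !inE => /orP[]/eqP->; apply: pS; rewrite !inE eqxx ?orbT.
  case: p IH py pS => [|y' p] IH py pS.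
    exists s; split=> // z /fs h; exists [set x; y]%SET; split => //.
  have [//|//|z zp|s' [ps' ls' fs']] := IH y; first by apply: pS; rewrite inE zp orbT.
  exists (s ++ s'); rewrite cat_path last_cat ls ps ps'; split => // z.
  rewrite -cat_cons mem_cat => /orP[/fs h|zs']; first by exists [set x; y]%SET.
  by apply: fs'; rewrite inE zs' orbT.
have {}chains i j : exists s, [/\ path (near_pt d) (pos (a i)) s,
    last (pos (a i)) s = pos (b j)
    & {in pos (a i) :: s, forall z, on_arc (A i :|: B j) z}].
  by have [p [pp <- p0 pS]] := walk i j; apply: chains.
have {chains} /choice[s sP] : forall ij : 'I_3 * 'I_3,
    exists s, [/\ path (near_pt d) (pos (a ij.1)) s,
    last (pos (a ij.1)) s = pos (b ij.2)
    & {in pos (a ij.1) :: s, forall z, on_arc (A ij.1 :|: B ij.2) z}].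
  by move=> [i j]; apply: chains.
apply: (@discrete_K33_nonplanar R d d0 (pos \o a) (pos \o b) (fun i j => s (i, j))).
- by move=> i j; have [] := sP (i, j).
- by move=> i j; have [] := sP (i, j).
move=> i j k l ik jl x y /(let: And3 _ _ h := sP (i, j) in h _)[e [eG eS ex]].
move=> /(let: And3 _ _ h := sP (k, l) in h _)[e' [e'G e'S ey]].
apply: (far e e') => //=; apply: disjointWl eS _; apply: disjointWr e'S _.
have [[dA _] [_ dB]] := (disj i k ik, disj j l jl).
rewrite finset.disjoints_subset; apply/fintype.subsetP => z.
rewrite finset.in_setC !finset.in_setU negb_or.
move=> /orP[zi|zj]; first by rewrite (disjointFr dA zi) (disjointFr (AB i l) zi).
by rewrite (disjointFr dB zj) (disjointFl (AB k j) zj).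
Qed.

(** The constant is [2 ^ 5]: a denser set would give six branch sets, and three against three of
    them form a K_{3,3}-minor. *)
Theorem planar_num_adj (S : {set V}) : planar R G ->
  (num_adj (adj G) S <= 32 * #|S|)%N.
Proof.
move=> plG; have [->|S0] := eqVneq S finset.set0.
  by rewrite /num_adj big_set0.
rewrite leqNgt; apply/negP => /ltnW dense.
have irr : irreflexive (adj G) by move=> x; apply/negP => /adj_neq; rewrite eqxx.
have [M [M1 M2]] := @clique_minor_of_dense V 5 _ S adj_sym irr S0 dense.
apply: (@planar_no_K33_minor (fun i => M i) (fun j => M (j + 3)%N) plG).
have lt3 (i : 'I_3) : (i < 6)%N by apply: ltn_trans (ltn_ord i) _.
have lt6 (i : 'I_3) : (i + 3 < 6)%N by rewrite (ltn_add2r 3 i 3).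
have ne (i j : 'I_3) : i != (j + 3)%N :> nat.
  by rewrite neq_ltn addnC ltn_addr // ltn_ord.
split.
- by move=> i; have [[_ _ ?] [_ _ ?]] := (M1 i (lt3 i), M1 (i + 3)%N (lt6 i)).
- by move=> i j ij; split; [have [] := M2 i j|have [] := M2 (i + 3)%N (j + 3)%N];
    rewrite ?eqn_add2r.
- by move=> i j; have [] := M2 i (j + 3)%N.
- by move=> i j; have [] := M2 i (j + 3)%N.
Qed.

(** Three common neighbours would form a K_{3,3} itself, a minor with singleton branch sets. *)
Theorem planar_common_nbrs x y z : planar R G -> uniq [:: x; y; z] ->
  (#|[set v | [&& adj G v x, adj G v y & adj G v z]]%SET| <= 2)%N.
Proof.
move=> plG xyz; rewrite leqNgt; apply/negP => /card_gt2P[a [b [c [[]]]]].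
rewrite !inE => ha hb hc [ab bc ca].
pose X (i : 'I_3) := nth x [:: x; y; z] i; pose Y (i : 'I_3) := nth a [:: a; b; c] i.
have uY : uniq [:: a; b; c] by rewrite /= !inE negb_or ab bc eq_sym ca.
have XY i j : adj G (Y j) (X i).
  rewrite /X /Y; move: ha hb hc => /and3P[? ? ?] /and3P[? ? ?] /and3P[? ? ?].
  by case: i => -[|[|[|]]] //= _; case: j => -[|[|[|]]] //=.
have X_inj i j : i != j -> X i != X j by rewrite /X nth_uniq.
have Y_inj i j : i != j -> Y i != Y j by rewrite /Y nth_uniq.
apply: (@planar_no_K33_minor (fun i => [set X i]%SET) (fun j => [set Y j]%SET) plG).
split.
- by move=> i; split=> u v /set1P -> /set1P ->.
- by move=> i j ij; rewrite !disjoints1 !inE X_inj // Y_inj.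
- by move=> i j; rewrite disjoints1 inE adj_neq // adj_sym.
- by move=> i j; exists (X i), (Y j); rewrite !inE !eqxx adj_sym.
Qed.
End PlanarNoK33.

(** * A straight-line drawing of the blow-up *)

Section Drawing.
Variables (R : realType) (n m : nat).
Hypothesis m2 : (2 < m)%N.

(* Hubs lie on the axis; the spokes of the last layer go above it, all others
   below. *)
Let height (v : nat) : R := (level m v).+1%:R.
(** Spokes of one layer share an abscissa strictly between those of their two hubs, so their pairs
    of segments are nested. *)
Let X (v : nat) : R := if (layer m v).+1 == m then 1 / 2 else (layer m v)%:R + 1 / 2.
Let Y (v : nat) : R := if (layer m v).+1 == m then height v else - height v.

Let pos (v : 'I_n) : R * R := if (v < m)%N then (v%:R, 0) else (X v, Y v).

Let segment (b s : nat) (t : R) : R * R := (b%:R + t * (X s - b%:R), t * Y s).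

(** Every arc starts at its hub; the default is never met on an edge. *)
Let arc (e : {set 'I_n}) (t : R) : R * R :=
  if [pick p : 'I_n * 'I_n | hub_spoke m p.1 p.2 && (e == [set p.1; p.2]%SET)]
  is Some p then segment p.1 p.2 t else (t, t).

Let layer_lt v : (layer m v < m)%N.
Proof. by rewrite ltn_pmod; lia. Qed.

Lemma layer_level_inj v v' : (m <= v)%N -> (m <= v')%N -> layer m v = layer m v' ->
  level m v = level m v' -> v = v'.
Proof.
rewrite /layer /level => mv mv' h1 h2.
by rewrite -(subnK mv) -(subnK mv') (divn_eq (v - m) m) (divn_eq (v' - m) m) h1 h2.
Qed.

Lemma Y_neq0 v : Y v != 0.
Proof. by rewrite /Y; case: ifP => _; rewrite ?oppr_eq0 pnatr_eq0. Qed.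

Lemma spoke_inj v v' : (m <= v)%N -> (m <= v')%N -> X v = X v' -> Y v = Y v' -> v = v'.
Proof.
rewrite /X /Y => mv mv'.
have L (u : nat) : 0 < height u by rewrite ltr0n.
have H : height v = height v' -> level m v = level m v'.
  by move/eqP; rewrite eqr_nat eqSS => /eqP.
case: eqP => [e|_]; case: eqP => [e'|_] => xx yy.
- apply: layer_level_inj => //; first by lia.
  exact: H.
- exfalso; have := L v; have := L v'; lra.
- exfalso; have := L v; have := L v'; lra.
- apply: layer_level_inj => //.
    by move/addIr/eqP: xx; rewrite eqr_nat => /eqP.
  exact/H/oppr_inj.
Qed.

(** Parameters equal to 1 are allowed so that spoke vertices are covered as well; there the two
    segments of a spoke meet, hence the proviso [t < 1]. *)
Lemma segment_inj b s b' s' t t' :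
    (m <= s)%N -> (m <= s')%N ->
    (b == layer m s) || (b == (layer m s).+1 %% m)%N ->
    (b' == layer m s') || (b' == (layer m s').+1 %% m)%N ->
    0 < t -> t <= 1 -> 0 < t' -> t' <= 1 -> segment b s t = segment b' s' t' ->
  [/\ s = s', t = t' & t < 1 -> b = b'].
Proof.
move=> ms ms' bs bs' t0 t1 t'0 t'1 [ex ey].
suff [XX tt bb] : [/\ X s = X s', t = t' & t < 1 -> b = b'].
  split=> //; apply: spoke_inj => //; apply: (mulfI (lt0r_neq0 t0)).
  by rewrite ey tt.
have L (u : nat) : 0 < height u by rewrite ltr0n.
have pY u : 0 < t * height u by rewrite mulr_gt0.
have pY' u : 0 < t' * height u by rewrite mulr_gt0.
move: ex ey; rewrite /X /Y.
have [e|ne] := eqVneq (layer m s).+1 m; have [e'|ne'] := eqVneq (layer m s').+1 m => ex ey.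
(* In the last layer, the segments from the hubs 0 and [m.-1] lie on either side of the abscissa
   1/2, which they reach only at the spoke. *)
- pose M : R := m.-1%:R; have M2 : 2 <= M by rewrite ler_nat; lia.
  have ends (u v : nat) : (layer m v).+1 = m ->
      (u == layer m v) || (u == (layer m v).+1 %% m)%N -> u%:R = 0 :> R /\ u = 0%N \/ u%:R = M /\ u = m.-1.
    move=> vm; rewrite vm modnn (_ : layer m v = m.-1); last by lia.
    by case/orP => /eqP->; [right|left].
  move: {ey} ex; case: (ends _ _ e bs) => -[-> ->]; case: (ends _ _ e' bs') => -[-> ->] ex.
  + by split=> //; lra.
  + have h : (M - 1 / 2) * (1 - t') <= 0 by lra.
    have : 1 - t' <= 0 by rewrite -(pmulr_rle0 _ (_ : 0 < M - 1 / 2)) //; lra.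
    move=> h1; have t'E : t' = 1 by lra.
    by rewrite t'E in ex *; split=> //; [lra|move=> ?; exfalso; lra].
  + have h : (M - 1 / 2) * (1 - t) <= 0 by lra.
    have : 1 - t <= 0 by rewrite -(pmulr_rle0 _ (_ : 0 < M - 1 / 2)) //; lra.
    move=> h1; have tE : t = 1 by lra.
    by rewrite tE in ex *; split=> //; [lra|move=> ?; exfalso; lra].
  + split=> //; apply/eqP; rewrite -subr_eq0 -(mulIr_eq0 _ (mulIf (_ : M - 1 / 2 != 0))).
      by apply/eqP; lra.
    by apply: lt0r_neq0; lra.
(* Opposite sides of the axis. *)
- exfalso; have := pY s; have := pY' s'; lra.
- exfalso; have := pY s; have := pY' s'; lra.
(* Below the axis, points with positive parameter in layer [i] have abscissa strictly between [i]
   and [i.+1], so different layers do not meet. *)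
- have lt1 : ((layer m s).+1 < m)%N by have := layer_lt s; lia.
  have lt1' : ((layer m s').+1 < m)%N by have := layer_lt s'; lia.
  rewrite modn_small // in bs; rewrite modn_small // in bs'.
  move: {ey} ex; set i := layer m s in bs *; set i' := layer m s' in bs' *.
  have cmp (u v : nat) : (u < v)%N -> u%:R + 1 <= v%:R :> R by rewrite natr1 ler_nat.
  have i1 : i.+1%:R = i%:R + 1 :> R by rewrite natr1.
  have i'1 : i'.+1%:R = i'%:R + 1 :> R by rewrite natr1.
  case/orP: bs => /eqP->; case/orP: bs' => /eqP->; rewrite ?i1 ?i'1 => ex.
  + have ii : i = i'.
      by case: (ltngtP i i') => // /cmp h; exfalso; lra.
    by rewrite -ii in ex *; split=> //; lra.
  + have ii : i = i'.
      by case: (ltngtP i i') => // /cmp h; exfalso; lra.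
    by rewrite -ii in ex *; split=> //; [lra|move=> ?; exfalso; lra].
  + have ii : i = i'.
      by case: (ltngtP i i') => // /cmp h; exfalso; lra.
    by rewrite -ii in ex *; split=> //; [lra|move=> ?; exfalso; lra].
  + have ii : i = i'.
      by case: (ltngtP i i') => // /cmp h; exfalso; lra.
    by rewrite -ii in ex *; split=> //; lra.
Qed.

Lemma hub_spokeP (b s : 'I_n) : hub_spoke m b s ->
  [/\ (b < m)%N, (m <= s)%N & ((b : nat) == layer m s) || ((b : nat) == (layer m s).+1 %% m)%N].
Proof. by case/and3P. Qed.

Lemma arcE e : e \in edges (cycle_blowup n m) ->
  exists b s : 'I_n, [/\ hub_spoke m b s, e = [set b; s]%SET & arc e = segment b s].
Proof.
move=> /mem_cycle_blowup[b0 [s0 [bs0 e0]]]; rewrite /arc.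
case: pickP => [[b s] /= /andP[bs /eqP ebs]|/(_ (b0, s0))]; first by exists b, s.
by rewrite /= bs0 e0 eqxx.
Qed.

Theorem planar_cycle_blowup : planar R (cycle_blowup n m).
Proof.
have pos_hub (v : 'I_n) : (v < m)%N -> pos v = (v%:R, 0) by rewrite /pos => ->.
have pos_spoke (v : 'I_n) : (m <= v)%N -> pos v = (X v, Y v) by rewrite /pos ltnNge => ->.
have seg0 b s : segment b s 0 = (b%:R, 0) by rewrite /segment !mul0r addr0.
have seg1 b s : segment b s 1 = (X s, Y s) by rewrite /segment !mul1r addrC subrK.
exists pos, arc; split.
- move=> v v'; have [vm|mv] := ltnP v m; have [vm'|mv'] := ltnP v' m.
  + rewrite !pos_hub // => -[/eqP]; rewrite eqr_nat => /eqP vv.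
    exact: val_inj.
  + by rewrite pos_hub // pos_spoke // => -[_ /esym/eqP]; rewrite (negbTE (Y_neq0 _)).
  + by rewrite pos_spoke // pos_hub // => -[_ /eqP]; rewrite (negbTE (Y_neq0 _)).
  + by rewrite !pos_spoke // => -[xx yy]; apply: val_inj; apply: spoke_inj.
- move=> e /arcE[b [s [bs eE ->]]]; have [bm ms _] := hub_spokeP bs; split.
  + have c2 (c : R) : continuous (fun t : R => t * c).
      by move=> t; apply: cvgM; [exact: cvg_id|exact: cvg_cst].
    have c1 : continuous (fun t : R => b%:R + t * (X s - b%:R)).
      by move=> t; apply: cvgD; [exact: cvg_cst|exact: c2].
    by apply: continuous_subspaceT => t; exact: (cvg_pair (c1 t) (c2 (Y s) t)).
  + move=> t t' _ _ [_ tt]; apply: (mulIf (Y_neq0 s)); exact: tt.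
  + by exists b, s; rewrite seg0 seg1 pos_hub // pos_spoke.
- move=> e v t /arcE[b [s [bs eE ->]]]; rewrite in_itv /= => /andP[t0 t1].
  have [bm ms ls] := hub_spokeP bs.
  have [vm|mv] := ltnP v m.
    rewrite pos_hub // => -[_ /eqP]; rewrite mulf_eq0 (negbTE (Y_neq0 _)) orbF.
    by rewrite gt_eqF.
  (* A spoke vertex is the end, at parameter 1, of the segment from one of its hubs. *)
  rewrite pos_spoke // -(seg1 (layer m v) v) => h.
  have [|_ te _] := segment_inj ms mv ls _ t0 (ltW t1) ltr01 (lexx 1) h.
    by rewrite eqxx.
  by rewrite te ltxx in t1.
- move=> e e' t t' /arcE[b [s [bs eE ->]]] /arcE[b' [s' [bs' eE' ->]]] ee'.
  rewrite !in_itv /= => /andP[t0 t1] /andP[t'0 t'1] h.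
  have [bm ms ls] := hub_spokeP bs; have [bm' ms' ls'] := hub_spokeP bs'.
  have [ss _ /(_ t1) bb] := segment_inj ms ms' ls ls' t0 (ltW t1) t'0 (ltW t'1) h.
  by case/eqP: ee'; rewrite eE eE' (val_inj ss) (val_inj bb).
Qed.
End Drawing.

(** * Optimal edge weights *)

Section Maximizer.
Variables (R : realType) (V : finType).
Implicit Types (w : V -> V -> R) (s : seq V).

Definition edge_weight w := [/\ forall x y, 0 <= w x y, forall x y, w x y = w y x
  & forall x, w x x = 0].

Definition total_weight w := \sum_x \sum_y w x y.

Lemma total_weight_ge0 w : edge_weight w -> 0 <= total_weight w.
Proof. by case=> w0 _ _; apply: sumr_ge0 => x _; apply: sumr_ge0. Qed.

Lemma uniq_cycles_weight_ge0 k w : edge_weight w -> 0 <= uniq_cycles_weight k (fun=> w).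
Proof. by case=> w0 _ _; apply: sumr_ge0 => s _; apply: cycle_weight_ge0. Qed.

Lemma uniq_cycles_weightZ k (c : R) w :
  uniq_cycles_weight k (fun _ x y => c * w x y) = c ^+ k * uniq_cycles_weight k (fun=> w).
Proof.
have walkZ v s : walk_weight (fun _ x y => c * w x y) v s =
    c ^+ size s * walk_weight (fun=> w) v s.
  elim: s v => [|u s IH] v /=; first by rewrite expr0 mulr1.
  by rewrite -[walk_weight _ u s]/(walk_weight _ u s) [X in _ * X]IH exprS mulrACA.
rewrite /uniq_cycles_weight mulr_sumr big_seq_cond [RHS]big_seq_cond.
apply: eq_bigr => -[|x s]; rewrite mem_seqs => /andP[/eqP <- _].
  by rewrite expr0 mul1r.
by rewrite /cycle_weight walkZ size_rcons.
Qed.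

Lemma eq_uniq_cycles_weight k w w' : (forall x y, w x y = w' x y) ->
  uniq_cycles_weight k (fun=> w) = uniq_cycles_weight k (fun=> w').
Proof.
move=> ww'; apply: eq_bigr => -[|x s] _ //=.
exact: eq_walk_weight.
Qed.

Lemma continuous_add (T : topologicalType) (f g : T -> R) :
  continuous f -> continuous g -> continuous (fun t => f t + g t).
Proof. by move=> cf cg t; apply: cvgD; [exact: cf|exact: cg]. Qed.

Lemma continuous_scale (T : topologicalType) (c : R) (f : T -> R) :
  continuous f -> continuous (fun t => c * f t).
Proof. by move=> cf t; apply: cvgM; [exact: cvg_cst|exact: cf]. Qed.

Section Continuity.
Variables (T : topologicalType) (w : T -> V -> V -> R).
Hypothesis cw : forall x y, continuous (fun f => w f x y).

Lemma continuous_uniq_cycles_weight k :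
  continuous (fun f => uniq_cycles_weight k (fun=> w f)).
Proof.
have walk v s : continuous (fun f => walk_weight (fun=> w f) v s).
  elim: s v => [|u s IH] v f; first exact: cvg_cst.
  by apply: cvgM; [exact: cw|exact: IH].
rewrite /uniq_cycles_weight; elim: (seqs V k) => [|s r IH] f.
  by under eq_fun do rewrite big_nil; exact: cvg_cst.
under eq_fun do rewrite big_cons; case: (uniq s); last exact: IH.
apply: cvgD; last exact: IH.
by case: s => [|x s]; [exact: cvg_cst|exact: walk].
Qed.

Lemma continuous_total_weight : continuous (fun f => total_weight (w f)).
Proof.
have sum_cts (F : V -> T -> R) : (forall x, continuous (F x)) ->
    continuous (fun f => \sum_x F x f).
  move=> cF; elim: (index_enum V) => [|x r IH] f.
    by under eq_fun do rewrite big_nil; exact: cvg_cst.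
  under eq_fun do rewrite big_cons.
  by apply: cvgD; [exact: cF|exact: IH].
have row x := sum_cts (fun y f => w f x y) (@cw x).
exact: (sum_cts (fun x f => \sum_y w f x y) row).
Qed.
End Continuity.

Local Open Scope classical_set_scope.
Local Open Scope ring_scope.

(** Compactness gives a maximiser among the weights of total at most 2, that is, 1 when each edge
    counts once; homogeneity of degree [k] extends the comparison to every weight. *)
Lemma uniq_cycles_weight_max k : (0 < k)%N -> exists w, [/\ edge_weight w, total_weight w <= 2 &
  forall w', edge_weight w' -> uniq_cycles_weight k (fun=> w') <=
    uniq_cycles_weight k (fun=> w) * (total_weight w' / 2) ^+ k].
Proof.
move=> k0; pose X := prod_topology (fun _ : V * V => (R : topologicalType)).
(* Points of a compact box are symmetrised, instead of cutting out the symmetric ones. *)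
pose sym (f : X) x y : R := (x != y)%:R * (f (x, y) + f (y, x)).
have proj xy : continuous (fun f : X => f xy : R).
  exact: (@proj_continuous (V * V)%type (fun=> (R : topologicalType)) xy).
have sym_cts x y : continuous (fun f => sym f x y).
  apply: (@continuous_scale X _ (fun f : X => f (x, y) + f (y, x))).
  exact: (@continuous_add X (fun f : X => f (x, y)) (fun f : X => f (y, x))).
pose A : set X := [set f | forall xy, `[0, 2]%classic (f xy)] `&`
  ((fun f => total_weight (sym f)) @^-1` [set t | t <= 2]).
have cA : compact A.
  apply: compact_closedI.
    by apply: (@tychonoff _ (fun=> R) (fun=> `[0, 2]%classic)) => _; exact: segment_compact.
  apply: preimage_closed; last exact: closed_le.
  by move=> f _; apply: (@continuous_total_weight X sym).
have A0 : A !=set0.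
  exists (fun=> 0); split => /=; first by move=> _; rewrite in_itv /= lexx ler0n.
  rewrite /total_weight big1 // => x _; rewrite big1 // => y _.
  by rewrite /sym addr0 mulr0.
have [|f /set_mem[f02 fT] fmax] := compact_EVT_max (f := fun f => uniq_cycles_weight k (fun=> sym f)) A0 cA.
  by apply: continuous_subspaceT; apply: continuous_uniq_cycles_weight.
have f0 xy : 0 <= f xy by have := f02 xy; rewrite /= in_itv /= => /andP[].
exists (sym f); split => //.
  split=> [x y|x y|x]; rewrite /sym.
  - by rewrite mulr_ge0 // addr_ge0.
  - by rewrite eq_sym addrC.
  - by rewrite eqxx mul0r.
move=> w' ew'; have [w'0 w's w'd] := ew'; set t := total_weight w'.
have t0 : 0 <= t := total_weight_ge0 ew'.
have [tz|tnz] := eqVneq t 0.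
  have w'z x y : w' x y = 0 * w' x y.
    move/eqP: tz; rewrite /t /total_weight psumr_eq0 => [/allP/(_ x)|u _]; last exact: sumr_ge0.
    rewrite mem_index_enum => /(_ isT) /=; rewrite psumr_eq0 => [/allP/(_ y)|u _]; last exact: w'0.
    by rewrite mem_index_enum => /(_ isT) /eqP ->; rewrite mul0r.
  rewrite (eq_uniq_cycles_weight _ w'z) uniq_cycles_weightZ tz mul0r.
  by rewrite !expr0n gtn_eqF // !mulr0n mul0r mulr0.
pose c := 2 / t.
have c0 : 0 < c by rewrite divr_gt0 // lt_neqAle eq_sym tnz.
(* The factor 1/2 offsets the two orders added up by [sym]. *)
pose g : X := fun xy => c / 2 * w' xy.1 xy.2.
have symg x y : sym g x y = c * w' x y.
  rewrite /sym /g /=; case: eqP => [->|_]; first by rewrite w'd !mulr0 mul0r.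
  by rewrite mul1r [w' y x]w's; field.
have gT : total_weight (sym g) = 2.
  rewrite /total_weight; under eq_bigr => x _ do
    (under eq_bigr => y _ do rewrite symg; rewrite -mulr_sumr).
  by rewrite -mulr_sumr -/(total_weight w') -/t divfK.
have gA : A g.
  split=> [[x y]|]; last by rewrite /= gT.
  rewrite /= in_itv /= /g /= mulr_ge0 ?divr_ge0 ?(ltW c0) //=.
  apply: (@le_trans _ _ (sym g x y)).
    rewrite symg ler_wpM2r // ler_pdivrMr // ler_pMr //; lra.
  rewrite -[leRHS]gT /total_weight (bigD1 x) //= (bigD1 y) //= -addrA lerDl.
  rewrite addr_ge0 ?sumr_ge0 // => [u _|u _]; last apply: sumr_ge0 => v _;
    by rewrite symg mulr_ge0 // ltW.
have := fmax g (mem_set gA).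
rewrite (eq_uniq_cycles_weight _ symg) uniq_cycles_weightZ /c.
have -> : (2 / t) ^+ k = ((t / 2) ^+ k)^-1 by rewrite -exprVn invf_div.
by rewrite mulrC ler_pdivrMr // exprn_gt0 // divr_gt0 // lt_neqAle eq_sym tnz.
Qed.
End Maximizer.

(** * Degrees and value of an optimal weight *)

Section Optimum.
Variables (R : realType) (V : finType) (l : nat).
Let k := l.+2.
Variable w : V -> V -> R.
Let Z (u : V -> V -> R) := uniq_cycles_weight k (fun=> u).
Let M := Z w.
Let P := closing_weight l w.
Let d x := \sum_y w x y.
Hypothesis ew : edge_weight w.
Hypothesis wT : total_weight w <= 2.
Hypothesis wmax : forall w', edge_weight w' -> Z w' <= M * (total_weight w' / 2) ^+ k.
Hypothesis M0 : 0 < M.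

Let w0 x y : 0 <= w x y. Proof. by case: ew. Qed.
Let ws x y : w x y = w y x. Proof. by case: ew. Qed.

(** The chord of a convex function on the unit interval. *)
Lemma expr1D_le (t : R) n : 0 <= t -> t <= 1 -> (1 + t) ^+ n <= 1 + t * (2 ^+ n - 1).
Proof.
move=> t0 t1; elim: n => [|n IH]; first by rewrite !expr0 subrr mulr0 addr0.
have p1 : (1 : R) <= 2 ^+ n by rewrite exprn_ege1 // ler1n.
have t10 : 0 <= 1 + t by rewrite addr_ge0.
rewrite exprS (le_trans (ler_wpM2l t10 IH)) // exprS.
move: (2 ^+ n) p1 => p p1.
have : 0 <= t * (p - 1) * (1 - t) by rewrite !mulr_ge0 // subr_ge0.
by lra.
Qed.

(** Convexity again: the tangent at [1 + t], evaluated at 1. *)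
Lemma expr1D_tangent (t : R) n : 0 <= t ->
  (1 + t) ^+ n.+1 <= 1 + t * (n.+1%:R * (1 + t) ^+ n).
Proof.
move=> t0; have t10 : 0 <= 1 + t by rewrite addr_ge0.
elim: n => [|n IH]; first by rewrite expr1 expr0 !mulr1.
have -> : 1 + t * (n.+2%:R * (1 + t) ^+ n.+1) =
  1 + t * (n.+1%:R * (1 + t) ^+ n) + t * (1 + t) ^+ n.+1 + t * (t * (n.+1%:R * (1 + t) ^+ n)).
  by rewrite -natr1 (exprS _ n); ring.
have -> : (1 + t) ^+ n.+2 = (1 + t) ^+ n.+1 + t * (1 + t) ^+ n.+1 by rewrite exprS; ring.
rewrite -[leLHS]addr0 lerD //; first by rewrite lerD.
by rewrite !mulr_ge0 // exprn_ge0.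
Qed.

(** Adding [t] to the edge [x y] raises the cycle weight by at least [t * (k%:R * (2 * P x y))],
    while by maximality the new value is at most [M * (1 + t) ^+ k]; then [t] is taken small. *)
Lemma closing_weight_le x y : x != y -> P x y <= M / 2.
Proof.
move=> xy; pose e u v : R := (((u, v) == (x, y)) || ((u, v) == (y, x)))%:R.
have e0 u v : 0 <= e u v by [].
have sumE (F : V -> V -> R) : \sum_u \sum_v e u v * F u v = F x y + F y x.
  have yx : y != x by rewrite eq_sym.
  have rowx : \sum_v e x v * F x v = F x y.
    rewrite (bigD1 y) //= big1 ?addr0 => [|v vy]; rewrite /e !xpair_eqE eqxx.
      by rewrite eqxx mul1r.
    by rewrite (negbTE vy) (negbTE xy) mul0r.
  have rowy : \sum_v e y v * F y v = F y x.
    rewrite (bigD1 x) //= big1 ?addr0 => [|v vx]; rewrite /e !xpair_eqE eqxx.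
      by rewrite eqxx orbT mul1r.
    by rewrite (negbTE vx) (negbTE yx) mul0r.
  rewrite (bigD1 x) //= rowx; congr (_ + _); rewrite (bigD1 y) //= rowy.
  rewrite big1 ?addr0 // => u /andP[ux uy].
  by rewrite big1 // => v _; rewrite /e !xpair_eqE (negbTE ux) (negbTE uy) mul0r.
have DZ : uniq_cycles_weight k (step_at w e 0) = 2 * P x y.
  rewrite uniq_cycles_weight_first sumE (closing_weight_sym _ y x ws) /P.
  by rewrite mulr_natl.
have bound t : 0 < t -> t <= 1 -> 2 * P x y <= M * (1 + t * (2 ^+ l.+1 - 1)).
  move=> t0 t1; have ee : edge_weight (fun u v => w u v + t * e u v).
    split=> [u v|u v|u].
    - by rewrite addr_ge0 // mulr_ge0 // ltW.
    - by rewrite ws /e orbC !xpair_eqE [(u == y) && _]andbC [(u == x) && _]andbC.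
    - case: ew => _ _ ->; rewrite add0r /e !xpair_eqE [(u == y) && _]andbC orbb.
      by case: eqP => [->|_]; rewrite ?(negbTE xy) mulr0.
  have eT : total_weight (fun u v => w u v + t * e u v) = total_weight w + 2 * t.
    rewrite /total_weight; under eq_bigr do rewrite big_split /= -mulr_sumr.
    rewrite big_split /= -mulr_sumr; congr (_ + _).
    rewrite (_ : \sum_u \sum_v e u v = \sum_u \sum_v e u v * (fun _ _ => 1) u v).
      by rewrite sumE mulrC.
    by apply: eq_bigr => u _; apply: eq_bigr => v _; rewrite mulr1.
  have := wmax ee; rewrite eT.
  have := @uniq_cycles_weight_perturb _ _ k w e t (ltW t0) w0 e0 isT.
  rewrite DZ -/(Z w) -/M -/(Z _) => h1 h2.
  have h3 : M + t * (k%:R * (2 * P x y)) <= M * (1 + t) ^+ k.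
    apply: le_trans h1 (le_trans h2 _); rewrite ler_pM2l //.
    have T0 := total_weight_ge0 ew.
    apply: lerXn2r; rewrite ?nnegrE.
    - by move: T0 t0; lra.
    - by rewrite addr_ge0 // ltW.
    - by move: wT; lra.
  have t10 : 0 <= 1 + t by rewrite addr_ge0 // ltW.
  have h4 := le_trans h3 (ler_wpM2l (ltW M0) (expr1D_tangent l.+1 (ltW t0))).
  have kt0 : 0 < t * k%:R by rewrite mulr_gt0 // ltr0n.
  rewrite -(ler_pM2l kt0) -(lerD2l M).
  have -> : M + t * k%:R * (2 * P x y) = M + t * (k%:R * (2 * P x y)) by ring.
  apply: le_trans h4 _.
  have -> : M * (1 + t * (l.+2%:R * (1 + t) ^+ l.+1)) =
     M + t * k%:R * (M * (1 + t) ^+ l.+1) by rewrite /k; ring.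
  by rewrite lerD2l !ler_wpM2l ?(ltW kt0) ?(ltW M0) // expr1D_le // ltW.
rewrite leNgt; apply/negP => big.
pose C : R := 2 ^+ l.+1 - 1.
have C0 : 0 <= C by rewrite subr_ge0 exprn_ege1 // ler1n.
(* Small enough that [M * t * C] is at most half of the supposed excess [2 * P x y - M]. *)
pose t := Num.min 1 ((2 * P x y - M) / (2 * (M * (C + 1)))).
have [t0 t1] : 0 < t /\ t <= 1.
  rewrite lt_min ltr01 divr_gt0 ?ge_min ?lexx //; first by rewrite subr_gt0; move: big; lra.
  by rewrite mulr_gt0 // mulr_gt0 // ltr_wpDl.
have := bound t t0 t1; rewrite -/C.
have tle : t <= (2 * P x y - M) / (2 * (M * (C + 1))) by rewrite ge_min lexx orbT.
have D0 : 0 < 2 * (M * (C + 1)) by rewrite mulr_gt0 // mulr_gt0 // ltr_wpDl.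
rewrite ler_pdivlMr // in tle.
by have := mulr_ge0 (ltW M0) (ltW t0); move: tle big; lra.
Qed.

Lemma uniq_cycles_weight_closing : M = \sum_x \sum_y w x y * P x y.
Proof.
rewrite /M /Z -uniq_cycles_weight_first; apply: eq_bigr => -[|x s] _ //=.
by apply: eq_walk_weight => i u v _; rewrite /step_at; case: eqP.
Qed.

(** [M] is the sum of the [w x y * P x y], which is at most [total_weight w * (M / 2)] and hence at
    most [M]; so equality holds throughout, term by term. *)
Lemma optimum_total : total_weight w = 2 /\
  forall x y, w x y * P x y = w x y * (M / 2).
Proof.
have le_xy x y : w x y * P x y <= w x y * (M / 2).
  have [->|xy] := eqVneq x y; first by case: ew => _ _ ->; rewrite !mul0r.
  by rewrite ler_wpM2l // closing_weight_le.
have sumM : \sum_x \sum_y w x y * (M / 2) = total_weight w * (M / 2).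
  by rewrite /total_weight [RHS]mulr_suml; apply: eq_bigr => x _; rewrite [RHS]mulr_suml.
have tw2 : total_weight w = 2.
  apply/le_anti; rewrite wT /=; rewrite -(@ler_pM2r _ (M / 2)) ?divr_gt0 //.
  rewrite -sumM mulrC divfK // [leLHS]uniq_cycles_weight_closing.
  by apply: ler_sum => x _; apply: ler_sum => y _; exact: le_xy.
split=> // x y; apply/eqP; rewrite eq_sym -subr_eq0.
have /eqP : \sum_x \sum_y (w x y * (M / 2) - w x y * P x y) = 0.
  under eq_bigr do rewrite sumrB.
  rewrite sumrB sumM tw2 -uniq_cycles_weight_closing mulrC divfK ?subrr //.
rewrite psumr_eq0 => [/allP/(_ x)|u _]; last by apply: sumr_ge0 => v _; rewrite subr_ge0.
rewrite mem_index_enum => /(_ isT) /=; rewrite psumr_eq0 => [/allP/(_ y)|u _]; last by rewrite subr_ge0.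
by rewrite mem_index_enum => /(_ isT).
Qed.

(** The cycles that avoid [x] have nonnegative weight, which is the first inequality; the second is
    maximality applied to [w] with [x] deleted. *)
Lemma optimum_degree x : 0 <= 1 - k%:R * d x / 2 /\ 1 - k%:R * d x / 2 <= (1 - d x) ^+ k.
Proof.
have [tw2 wP] := optimum_total.
have through : \sum_(s <- seqs V k | uniq s && (x \in s)) cycle_weight (fun=> w) s =
    M * (k%:R * d x / 2).
  rewrite cycles_through cycles_through_head.
  have -> : \sum_y w x y * closing_weight l w x y = d x * (M / 2).
    by rewrite /d [RHS]mulr_suml; apply: eq_bigr => y _; rewrite -wP.
  by ring.
pose w1 u v := if (u == x) || (v == x) then 0 else w u v.
have ew1 : edge_weight w1.
  split=> [u v|u v|u]; rewrite /w1; first by case: ifP.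
    by rewrite orbC ws.
  by case: ifP => // _; case: ew.
have tw1 : total_weight w1 = 2 - 2 * d x.
  rewrite -[X in _ = X - _]tw2 /total_weight (bigD1 x) //= [in RHS](bigD1 x) //=.
  rewrite [X in X + _ = _]big1 ?add0r; last by move=> v _; rewrite /w1 eqxx.
  rewrite -/(d x).
  have -> : \sum_(i | i != x) \sum_y w i y = \sum_(i | i != x) \sum_y w1 i y + d x.
    have -> : d x = \sum_(i | i != x) w i x.
      rewrite /d (bigD1 x) //=; case: ew => _ _ ->; rewrite add0r.
      by apply: eq_bigr => y _.
    rewrite -big_split /=; apply: eq_bigr => u ux.
    rewrite (bigD1 x) //= [in RHS](bigD1 x) //= [in RHS]/w1 eqxx orbT add0r addrC.
    by congr (_ + _); apply: eq_bigr => v vx; rewrite (negbTE ux) (negbTE vx).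
  by ring.
have avoid : \sum_(s <- seqs V k | uniq s && (x \notin s)) cycle_weight (fun=> w) s =
    M * (1 - k%:R * d x / 2).
  rewrite mulrBr mulr1 -through /M /Z /uniq_cycles_weight.
  by rewrite [X in _ = X - _](bigID (fun s => x \in s)) /= addrAC subrr add0r.
have avoid0 : 0 <= M * (1 - k%:R * d x / 2).
  by rewrite -avoid; apply: sumr_ge0 => s _; apply: cycle_weight_ge0.
split; first by rewrite -(pmulr_rge0 _ M0).
rewrite -(ler_pM2l M0) -avoid.
have -> : 1 - d x = total_weight w1 / 2 by rewrite tw1; field.
apply: le_trans (wmax ew1).
rewrite /Z /uniq_cycles_weight [X in _ <= X](bigID (fun s => x \in s)) /= addrC.
rewrite -[leLHS]addr0 lerD ?sumr_ge0 // => [|s _]; last first.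
  by apply: cycle_weight_ge0; case: ew1.
apply: ler_sum => s /andP[_ xs].
have walk_eq v t : v != x -> x \notin t ->
    walk_weight (fun=> w) v t = walk_weight (fun=> w1) v t.
  elim: t v => //= u t IH v vx; rewrite inE negb_or eq_sym => /andP[ux xt].
  by rewrite /w1 (negbTE vx) (negbTE ux); congr (_ * _); apply: IH.
case: s xs => //= y s; rewrite inE negb_or => /andP[xy xs].
rewrite walk_eq ?lexx //; first by rewrite eq_sym.
by rewrite mem_rcons inE negb_or xy.
Qed.

Hypothesis l0 : (0 < l)%N.
(** Together with [optimum_degree] it forces every positive degree above [2 / k.+1%:R], so that at
    most [k] of them fit into the total 2. *)
Hypothesis degree_gap : forall t : R, 0 < t -> t <= 2 / k.+1%:R ->
  (1 - t) ^+ k < 1 - k%:R * t / 2.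

Lemma optimum_regular x : d x = 0 \/ d x = 2 / k%:R.
Proof.
have [tw2 wP] := optimum_total.
have d0 u : 0 <= d u by apply: sumr_ge0.
have k0 : 0 < k%:R :> R by rewrite ltr0n.
have dle u : d u <= 2 / k%:R.
  rewrite ler_pdivlMr // mulrC; have [] := optimum_degree u; lra.
pose X := [set u | d u != 0]%SET.
have dX u : u \in X -> 2 / k.+1%:R < d u.
  rewrite inE => du; rewrite ltNge; apply/negP => /degree_gap.
  rewrite lt_neqAle eq_sym du d0 => /(_ isT); have [] := optimum_degree u; lra.
have sumX : \sum_(u in X) d u = 2.
  rewrite -tw2 /total_weight [RHS](bigID (mem X)) /= [X in _ = _ + X]big1 ?addr0 //.
  by move=> u; rewrite inE negbK => /eqP.
have cardX : (#|X| <= k)%N.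
  rewrite -ltnS -(ltr_nat R) ltNge; apply/negP => big.
  have : \sum_(u in X) (2 / k.+1%:R) < \sum_(u in X) d u :> R.
    apply: ltr_sum => //; apply/hasP.
    have /card_gt0P[u uX] : (0 < #|X|)%N by rewrite -(ltr_nat R) (lt_le_trans _ big) ?ltr0n.
    by exists u => //; rewrite mem_index_enum.
  rewrite sumX sumr_const -[_ *+ #|X|]mulr_natr ltNge => /negP; apply.
  by rewrite mulrAC ler_pdivlMr ?ltr0n // ler_pM2l.
have [->|dx] := eqVneq (d x) 0; [by left|right].
have xX : x \in X by rewrite inE.
have : \sum_(u in X) (2 / k%:R - d u) <= 0.
  rewrite sumrB sumX sumr_const -[_ *+ #|X|]mulr_natr subr_le0 mulrAC ler_pdivrMr //.
  by rewrite ler_pM2l // ler_nat.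
rewrite (bigD1 x) //= => h; apply/le_anti; rewrite dle /=.
have : 0 <= \sum_(u in X | u != x) (2 / k%:R - d u) by apply: sumr_ge0 => u _; rewrite subr_ge0.
by move: h; lra.
Qed.

Lemma optimum_value : M <= 2 / k%:R * k%:R^-1 ^+ l.
Proof.
have [tw2 wP] := optimum_total.
have k0 : 0 < k%:R :> R by rewrite ltr0n.
have [x dx] : exists x, d x != 0.
  apply/existsP; apply: contraT; rewrite negb_exists => /forallP h.
  have : (2 : R) = 0 by rewrite -tw2 /total_weight big1 // => u _; have := h u; rewrite negbK => /eqP.
  by move/eqP; rewrite pnatr_eq0.
have dxk : d x = 2 / k%:R by case: (optimum_regular x) => // d0; rewrite d0 eqxx in dx.
have Pge0 u v : 0 <= P u v by apply: sumr_ge0 => s _; apply: walk_weight_ge0.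
have PM u v : w u v != 0 -> P u v = M / 2 by move=> uv; apply: (mulfI uv); exact: wP.
have [y wxy] : exists y, w x y != 0.
  apply/existsP; apply: contraT; rewrite negb_exists => /forallP h.
  by case/eqP: dx; rewrite /d big1 // => u _; have := h u; rewrite negbK => /eqP.
(* A path of positive weight closing the edge [x y] returns to [x] through a neighbour other than
   [y], since [l] is positive. *)
have [z zy wxz] : exists2 z, z != y & w x z != 0.
  have : P x y != 0 by rewrite PM // gt_eqF // divr_gt0.
  rewrite /P /closing_weight psumr_eq0 => [/allPn[s]|s _]; last exact: walk_weight_ge0.
  rewrite mem_seqs => /eqP sl; rewrite negb_imply => /andP[us].
  rewrite walk_weight_rcons mulf_eq0 negb_or => /andP[_ wl].
  case: s sl us wl => [|u s] sl us wl; first by move: l0; rewrite -sl.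
  exists (last u s); last by rewrite ws.
  case/and3P: us => _ yus _; apply: contraNneq yus => <-; exact: mem_last.
have Mle : M <= \sum_u P x u.
  rewrite (bigD1 y) //= (bigD1 z) //= !PM // addrA -splitr lerDl.
  by apply: sumr_ge0.
apply: le_trans Mle _; rewrite sum_closing_weight // big_seqsS.
have inner : inner_weight w (~: [set x])%SET = 2 - 2 * d x.
  rewrite -[X in _ = X - _]tw2 /inner_weight /total_weight [in RHS](bigD1 x) //= -/(d x).
  have -> : \sum_(i | i != x) \sum_y w i y =
    \sum_(i in (~: [set x])%SET) \sum_(y in (~: [set x])%SET) w i y + d x.
    have -> : d x = \sum_(i in (~: [set x])%SET) w i x.
      rewrite /d (bigD1 x) //=; case: ew => _ _ ->; rewrite add0r.
      by apply: eq_big => [u|u _]; rewrite ?in_setC1.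
    rewrite -big_split /=; apply: eq_big => [u|u _]; first by rewrite in_setC1.
    rewrite (bigD1 x) //= addrC; congr (_ + _).
    by apply: eq_bigl => v; rewrite in_setC1.
  by ring.
(* As [d x = 2 / k] and [k = l + 2], the weight left after deleting [x] is [1 - 2 / k], which is
   [1 / k] for each of [l] steps. *)
have -> : 2 / k%:R * k%:R^-1 ^+ l = \sum_u w x u * (inner_weight w (~: [set x])%SET / 2 / l%:R) ^+ l.
  rewrite -mulr_suml -/(d x) dxk inner dxk; congr (_ * _ ^+ _).
  have ln0 : l%:R != 0 :> R by rewrite pnatr_eq0 -lt0n.
  have -> : k%:R = l%:R + 2 :> R by rewrite /k -addn2 natrD.
  have : l%:R + 2 != 0 :> R by rewrite -natrD pnatr_eq0 addn2.
  by move=> ?; field; apply/andP.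
apply: ler_sum => u _; have [->|ux] := eqVneq u x.
  case: ew => _ _ ->; rewrite mul0r big1 // => s /=; by rewrite inE eqxx.
have uA : u \in (~: [set x])%SET by rewrite in_setC1.
apply: le_trans (ler_wpM2l (w0 x u) (walks_weight_le l w0 ws uA)).
rewrite mulr_sumr big_mkcond [leRHS]big_mkcond; apply: ler_sum => s _.
case: ifPn => [|_]; last by case: ifP => // _; rewrite mulr_ge0 // walk_weight_ge0.
rewrite /= inE negb_or => /and3P[/andP[_ xs] us uqs]; rewrite ifT // us uqs /=.
by apply/allP => v vs; rewrite /= in_setC1; apply: contraNneq xs => <-.
Qed.
End Optimum.

(** The factors 2 come from the conventions: lists count each cycle [2 * k] times and [total_weight]
    counts each edge twice. By homogeneity the bound at the maximiser suffices. *)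
Theorem uniq_cycles_weight_le (R : realType) (V : finType) k (w : V -> V -> R) :
    k = 5%N \/ k = 6%N -> edge_weight w ->
  uniq_cycles_weight k (fun=> w) <= 2 * k%:R * (total_weight w / (2 * k%:R)) ^+ k.
Proof.
move=> k56 ew.
have [l kl l0] : exists2 l, k = l.+2 & (0 < l)%N by case: k56 => ->; [exists 3%N|exists 4%N].
have gap (t : R) : 0 < t -> t <= 2 / l.+3%:R -> (1 - t) ^+ l.+2 < 1 - l.+2%:R * t / 2.
  have : l = 3%N \/ l = 4%N by case: k56; rewrite kl => -[->]; auto.
  move=> l34 t0; rewrite ler_pdivlMr ?ltr0n //.
  case: l34 => -> h; rewrite -subr_gt0.
    (* Factoring out [t] removes the zero at the origin; the cofactor is positive up to [2 / k.+1],
       here 1/3. *)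
    have -> : 1 - 5%:R * t / 2 - (1 - t) ^+ 5 =
      t * (5 / 2 - 10 * t + 10 * t ^+ 2 - 5 * t ^+ 3 + t ^+ 4) by field.
    have h1 : t <= 1 / 3 by lra.
    have h2 : 0 <= t ^+ 2 * (1 / 3 - t) by rewrite mulr_ge0 ?sqr_ge0 // subr_ge0.
    have h3 := sqr_ge0 (t - 1 / 3).
    have h4 : 0 <= t ^+ 4 by rewrite exprn_ge0 // ltW.
    by rewrite mulr_gt0 //; lra.
  have -> : 1 - 6%:R * t / 2 - (1 - t) ^+ 6 =
    t * (3 - 15 * t + 20 * t ^+ 2 - 15 * t ^+ 3 + 6 * t ^+ 4 - t ^+ 5) by field.
  have h1 : t <= 2 / 7 by lra.
  (* second-order Taylor expansion of the cofactor at [2 / 7] *)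
  have h2 : 0 <= 4392 / 343 - 579 / 49 * t + 38 / 7 * t ^+ 2 - t ^+ 3.
    have : 0 <= t * ((2 / 7) ^+ 2 - t ^+ 2).
      by rewrite mulr_ge0 ?(ltW t0) // subr_ge0 lerXn2r // nnegrE ?(ltW t0) // divr_ge0.
    by have := sqr_ge0 t; lra.
  have h3 := mulr_ge0 (sqr_ge0 (t - 2 / 7)) h2.
  by rewrite mulr_gt0 //; lra.
have [|w' [ew' tw' wmax]] := @uniq_cycles_weight_max R V k; first by rewrite kl.
have k0 : 0 < k%:R :> R by rewrite kl ltr0n.
have bound : uniq_cycles_weight k (fun=> w') <= 2 * k%:R * (k%:R^-1) ^+ k.
  have := uniq_cycles_weight_ge0 k ew'; rewrite le_eqVlt => /predU1P[<-|M0].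
    by rewrite !mulr_ge0 ?exprn_ge0 ?invr_ge0 // ltW.
  rewrite kl in wmax M0 k0 *; apply: le_trans (optimum_value ew' tw' wmax M0 l0 gap) _.
  by rewrite !exprS [leRHS]mulrA mulfK ?gt_eqF // [leRHS]mulrA.
apply: le_trans (wmax w ew) _.
apply: le_trans (ler_wpM2r _ bound) _; first by rewrite exprn_ge0 // divr_ge0 // total_weight_ge0.
have -> : total_weight w / (2 * k%:R) = k%:R^-1 * (total_weight w / 2).
  by field; rewrite gt_eqF.
by rewrite [(k%:R^-1 * _) ^+ k]exprMn mulrA.
Qed.

(** * Asymptotics *)

Section CycleBound.
Variables (R : realType) (V : finType) (r : rel V) (C K m : nat).
Hypotheses (rs : symmetric r) (ri : irreflexive r).
Hypothesis sparse : forall S, (num_adj r S <= C * #|S|)%N.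
Hypothesis common : forall x y z, uniq [:: x; y; z] ->
  (#|[set v | [&& r v x, r v y & r v z]]%SET| <= 2)%N.
Hypothesis m56 : m = 5%N \/ m = 6%N.
Hypothesis K0 : (0 < K)%N.
Hypothesis n0 : (0 < #|V|)%N.

Let w (b b' : V) : R := #|mids r K b b'|%:R.

Lemma mids_edge_weight : edge_weight w.
Proof.
split=> [b b'|b b'|b]; rewrite /w; first exact: ler0n.
  by rewrite mids_sym.
by rewrite midsxx cards0.
Qed.

Lemma size_choices b : (size (choices r K b))%:R = cycle_weight (fun=> w) b :> R.
Proof.
have path v t : (size (choices_path r K v t))%:R = walk_weight (fun=> w) v t :> R.
  elim: t v => //= u t IH v.
  by rewrite size_allpairs natrM -cardE IH.
by case: b => [|x b]; [|exact: path].
Qed.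

(** The factor [4 * m%:R] is the number of lists describing one cycle. The first error term gathers
    heavy pairs and rich vertices, the second the light pairs. *)
Lemma count_cycles_le_real :
  (count (fun s => cycle r s && uniq s) (seqs V m.*2))%:R <=
  4 * m%:R * (#|V|%:R / m%:R) ^+ m
  + m.*2.+1%:R * (3 * (K * C)%:R ^+ 4 * (C%:R * #|V|%:R) ^+ m.-1
     + (C%:R * #|V|%:R) ^+ m / K%:R) :> R.
Proof.
set n := #|V|.
have m2 : (1 < m)%N by case: m56 => ->.
have m0 : 0 < m%:R :> R by rewrite ltr0n ltnW.
have KR0 : 0 < K%:R :> R by rewrite ltr0n.
have := count_cycles_le r K m2; rewrite -(ler_nat R) => /le_trans; apply.
rewrite natrD [leRHS]addrC lerD //; last first.
  have -> : (\sum_(b <- seqs V m | uniq b) size (choices r K b)).*2%:R =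
      2 * uniq_cycles_weight m (fun=> w) :> R.
    rewrite -muln2 natrM mulrC natr_sum; congr (_ * _).
    by apply: eq_bigr => b _; rewrite size_choices.
  have -> : 4 * m%:R * (n%:R / m%:R) ^+ m = 2 * (2 * m%:R * (n%:R / m%:R) ^+ m) :> R by ring.
  rewrite ler_pM2l //; apply: le_trans (uniq_cycles_weight_le m56 mids_edge_weight) _.
  rewrite ler_pM2l ?mulr_gt0 //.
  have T0 := total_weight_ge0 mids_edge_weight.
  apply: lerXn2r; rewrite ?nnegrE; [by rewrite divr_ge0 // mulr_ge0 // ltW|by rewrite divr_ge0 // ltW|].
  have -> : n%:R / m%:R = 2 * n%:R / (2 * m%:R) :> R by field; rewrite gt_eqF.
  rewrite ler_pM2r ?invr_gt0 ?mulr_gt0 //.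
  rewrite /total_weight /w; under eq_bigr do rewrite -natr_sum.
  by rewrite -natr_sum -natrM ler_nat mulnC; apply: total_mids.
rewrite natrM ler_pM2l ?ltr0n //.
have eCn : (size (adj_pairs r))%:R <= C%:R * n%:R :> R.
  by rewrite -natrM ler_nat size_adj_pairs; apply: num_adjT sparse.
have e0 : 0 <= (size (adj_pairs r))%:R :> R by [].
have NB : (#|heavy r K| * #|heavy r K| + #|rich r K| * #|heavy r K| <= 3 * (K * C) ^ 4)%N.
  have B_le := card_heavy K sparse n0; have R_le := card_rich K common.
  apply: (@leq_trans (3 * #|heavy r K| ^ 4)); last by rewrite leq_mul2l leq_exp2r.
  rewrite (_ : (3 * #|heavy r K| ^ 4 = #|heavy r K| ^ 4 + 2 * #|heavy r K| ^ 3 * #|heavy r K|)%N).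
    rewrite leq_add //; last by rewrite leq_mul2r R_le orbT.
    by case: #|heavy r K| => // b; rewrite -[X in (X <= _)%N]/(b.+1 ^ 2)%N leq_pexp2l.
  by rewrite -mulnA -expnSr; lia.
have Cn0 : 0 <= C%:R * n%:R :> R by rewrite mulr_ge0.
have powe j : (size (adj_pairs r) ^ j)%:R <= (C%:R * n%:R) ^+ j :> R.
  by rewrite natrX; apply: lerXn2r.
have SP : (size (small_paths r K))%:R <= (C%:R * n%:R) ^+ 2 / K%:R :> R.
  rewrite ler_pdivlMr // mulrC -natrM -natrM -natrX ler_nat.
  by rewrite expnS expn1 -mulnA mulnCA; apply: size_small_paths.
have E : (C%:R * n%:R) ^+ m / K%:R = (C%:R * n%:R) ^+ 2 / K%:R * (C%:R * n%:R) ^+ m.-2 :> R.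
  by rewrite mulrAC -exprD; congr (_ ^+ _ / _); move: m2; lia.
rewrite E addnAC -mulnDl natrD lerD //.
  rewrite [leLHS]natrM; apply: ler_pM => //.
  by rewrite -natrX -natrM ler_nat.
by rewrite [leLHS]natrM; apply: ler_pM.
Qed.
End CycleBound.

Section Asymptotics.
Variables (R : realType) (m : nat).
Hypothesis m56 : m = 5%N \/ m = 6%N.

Let m0 : (0 < m)%N. Proof. by case: m56 => ->. Qed.

Lemma bernoulli (x : R) k : 0 <= x -> x <= 1 -> 1 - k%:R * x <= (1 - x) ^+ k.
Proof.
move=> x0 x1; elim: k => [|k IH]; first by rewrite expr0 mul0r subr0.
rewrite exprS; apply: le_trans (ler_wpM2l _ IH); last by rewrite subr_ge0.
rewrite -natr1; have : 0 <= k%:R * x * x by rewrite !mulr_ge0.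
by move: (k%:R : R) => c; lra.
Qed.

Lemma max_planar_copies_le n K : (0 < n)%N -> (0 < K)%N ->
  (max_planar_copies R n (cycle_graph (2 * m)))%:R <=
  (n%:R / m%:R) ^+ m + (2 * m).+1%:R * (3 * (K * 32)%:R ^+ 4 * (32%:R * n%:R) ^+ m.-1
     + (32%:R * n%:R) ^+ m / K%:R) :> R.
Proof.
move=> n0 K0; set bound := (X in _ <= X).
have bound0 : 0 <= bound by rewrite /bound addr_ge0 ?mulr_ge0 ?addr_ge0 ?mulr_ge0 ?exprn_ge0 ?divr_ge0.
rewrite /max_planar_copies; elim/big_ind: _ => //.
  by move=> x y hx hy; rewrite /maxn; case: ifP.
move=> G /asboolP plG.
have sparse S : (num_adj (adj G) S <= 32 * #|S|)%N by exact: planar_num_adj plG.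
have common x y z : uniq [:: x; y; z] ->
  (#|[set v | [&& adj G v x, adj G v y & adj G v z]]%SET| <= 2)%N.
  exact: planar_common_nbrs plG.
have nV : (0 < #|'I_n|)%N by rewrite card_ord.
have := count_cycles_le_real R (@adj_sym _ G) sparse common m56 K0 nV.
rewrite card_ord => cnt.
have : (num_copies G (cycle_graph (2 * m)) * (2 * m).*2)%:R <=
    4 * m%:R * (n%:R / m%:R) ^+ m + (2 * m).+1%:R * (3 * (K * 32)%:R ^+ 4 * (32%:R * n%:R) ^+ m.-1
     + (32%:R * n%:R) ^+ m / K%:R) :> R.
  rewrite mul2n; apply: le_trans cnt; rewrite ler_nat; apply: num_copies_cycle_le.
  by case: m56 => ->.
set E := _.+1%:R * _; have E0 : 0 <= E.
  by rewrite mulr_ge0 ?addr_ge0 ?mulr_ge0 ?exprn_ge0 ?divr_ge0.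
have -> : (num_copies G (cycle_graph (2 * m)) * (2 * m).*2)%:R =
  4 * m%:R * (num_copies G (cycle_graph (2 * m)))%:R :> R.
  by rewrite -!natrM; congr (_%:R); rewrite -muln2; lia.
(* Only the leading term is divided by [4 * m]; the error term is kept as it is. *)
move=> h; have m4 : 1 <= 4 * m%:R :> R by rewrite -natrM ler1n muln_gt0 m0.
rewrite -(ler_pM2l (lt_le_trans ltr01 m4)) /bound mulrDr.
by apply: le_trans h _; rewrite lerD2l ler_peMl.
Qed.

(** The blow-up has at least n/m - 2 complete levels, and Bernoulli's inequality expands the
    power. *)
Lemma max_planar_copies_ge n : (m <= n)%N ->
  (n%:R / m%:R) ^+ m * (1 - m%:R * (2 * m%:R / n%:R)) <=
  (max_planar_copies R n (cycle_graph (2 * m)))%:R :> R.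
Proof.
move=> mn; have m2 : (2 < m)%N by case: m56 => ->.
have n0 : 0 < n%:R :> R by rewrite ltr0n (leq_trans m0).
have mR0 : 0 < m%:R :> R by rewrite ltr0n.
have [small|large] := leP (n%:R : R) (2 * m%:R).
  (* For small [n] the left-hand side is not positive. *)
  apply: (@le_trans _ _ 0) => //; rewrite mulr_ge0_le0 ?exprn_ge0 ?divr_ge0 //.
  have h : 1 <= 2 * m%:R / n%:R :> R by rewrite ler_pdivlMr // mul1r.
  by rewrite subr_le0 (le_trans h) // ler_peMl ?(le_trans ler01 h) // ler1n.
have x1 : 2 * m%:R / n%:R <= 1 :> R by rewrite ler_pdivrMr // mul1r ltW.
have x0 : 0 <= 2 * m%:R / n%:R :> R by rewrite divr_ge0 ?mulr_ge0 ?ltW.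
apply: le_trans (ler_wpM2l _ (bernoulli m x0 x1)) _; first by rewrite exprn_ge0 // divr_ge0.
rewrite -exprMn; set q := ((n - m) %/ m)%N.
apply: (@le_trans _ _ (q ^ m)%:R); last first.
  rewrite ler_nat (leq_trans (num_copies_blowup n m2)) //.
  apply: (@leq_bigmax_cond _ _ (fun G => num_copies G (cycle_graph (2 * m)))).
  by apply/asboolP; exact: planar_cycle_blowup.
rewrite natrX; apply: lerXn2r; rewrite ?nnegrE //.
  by rewrite mulr_ge0 ?divr_ge0 // subr_ge0.
have -> : n%:R / m%:R * (1 - 2 * m%:R / n%:R) = n%:R / m%:R - 2 :> R.
  by field; rewrite !gt_eqF.
rewrite lerBlDr ler_pdivrMr // -natrD -natrM ler_nat.
have := divn_eq (n - m) m; have := ltn_pmod (n - m) m0; rewrite -/q; lia.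
Qed.

Lemma max_planar_copies_asymp (eps : R) : 0 < eps -> \forall n \near \oo%classic,
  `|(max_planar_copies R n (cycle_graph (2 * m)))%:R - (n%:R / m%:R) ^+ m| <= eps * `|n%:R ^+ m : R|.
Proof.
move=> e0; pose c : R := (2 * m).+1%:R * 32%:R ^+ m.
have c0 : 0 <= c by rewrite mulr_ge0 // exprn_ge0.
(* [K] is fixed first, so that light pairs cost at most [eps / 2]; the constant [A], which depends
   on [K], is then absorbed by taking [n] large. *)
pose K := (Num.truncn (2 * c / eps)).+1.
have Kc : c / K%:R <= eps / 2.
  have : 2 * c / eps < K%:R by rewrite truncnS_gt.
  rewrite ltr_pdivrMr // => h; rewrite ler_pdivrMr ?ltr0n // mulrAC ler_pdivlMr //.
  by rewrite mulrC [eps * _]mulrC ltW.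
pose A : R := (2 * m).+1%:R * (3 * (K * 32)%:R ^+ 4 * 32%:R ^+ m.-1).
near=> n.
have mn : (m <= n)%N by near: n; exact: nbhs_infty_ge.
have nA : 2 * A / eps <= n%:R by near: n; exact: nbhs_infty_ger.
have nm : 2 * m%:R ^+ 2 / eps <= n%:R :> R by near: n; exact: nbhs_infty_ger.
have n0 : (0 < n)%N := leq_trans m0 mn.
have nR0 : 0 < n%:R :> R by rewrite ltr0n.
have nm0 : 0 < n%:R ^+ m :> R by rewrite exprn_gt0.
have mR1 : 1 <= m%:R :> R by rewrite ler1n.
rewrite (ger0_norm (ltW nm0)) ler_norml lerBrDr lerBlDr; apply/andP; split.
  apply: le_trans (max_planar_copies_ge mn).
  rewrite mulrBr mulr1 addrC lerB //.
  have pow_le : (n%:R / m%:R) ^+ m <= n%:R ^+ m :> R.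
    apply: lerXn2r; rewrite ?nnegrE ?divr_ge0 //.
    by rewrite ler_pdivrMr ?(lt_le_trans ltr01) // ler_peMr // ltW.
  rewrite [leLHS]mulrC; apply: ler_pM => //.
  rewrite mulrA ler_pdivrMr // -ler_pdivrMl // mulrC.
  by apply: le_trans nm; rewrite expr2 mulrCA.
have K0 : (0 < K)%N by [].
apply: le_trans (max_planar_copies_le n0 K0) _; rewrite addrC lerD2r.
have -> : (2 * m).+1%:R * (3 * (K * 32)%:R ^+ 4 * (32%:R * n%:R) ^+ m.-1
     + (32%:R * n%:R) ^+ m / K%:R) = A * n%:R ^+ m.-1 + c / K%:R * n%:R ^+ m :> R.
  by rewrite /A /c !exprMn; ring.
have -> : eps * n%:R ^+ m = eps / 2 * n%:R ^+ m + eps / 2 * n%:R ^+ m by rewrite -mulrDl -splitr.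
rewrite lerD //; last by rewrite ler_pM2r.
rewrite -{2}(prednK m0) exprS mulrA ler_wpM2r ?exprn_ge0 //.
by rewrite mulrAC ler_pdivlMr // -ler_pdivrMl // mulrC [A * 2]mulrC.
Unshelve. all: by end_near. Qed.
End Asymptotics.

Local Open Scope classical_set_scope.
Local Open Scope ring_scope.

Theorem theorem1p1 (R : realType) (m : nat) (hm : m = 5%N \/ m = 6%N) :
  (fun n : nat => (max_planar_copies R n (cycle_graph (2 * m)))%:R : R) =
    (fun n : nat => (n%:R / m%:R) ^+ m : R)
    +o_\oo (fun n : nat => n%:R ^+ m : R).
Proof.
by apply/eqaddoP => eps e0; exact: max_planar_copies_asymp.
Qed.
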